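(* Let $T$ be a tree with $t\geq 3$ vertices and radius $h$, and let $G$ be a graph that does not contain $T$ as a minor. Then there exists a graph $H$ with $\mathrm{pw}(H)\leq 2h-1$ such that $G$ is contained in $H\boxtimes K_{t-2}$.
   Context: All graphs are simple, finite and undirected. $\mathrm{pw}$ denotes pathwidth, $K_c$ is the complete graph on $c$ vertices, and $\boxtimes$ is the strong product: $V(G\boxtimes H)=V(G)\times V(H)$, and distinct $(v,w),(v',w')$ are adjacent iff ($v=v'$ or $vv'\in E(G)$) and ($w=w'$ or $ww'\in E(H)$). ''$G$ is contained in $J$'' means $G$ is isomorphic to a subgraph of $J$. *)

(* Defs.v *)
From HB Require Import structures.
From mathcomp Require Import all_boot.
From mathcomp Require Import boolp.

Set Implicit Arguments.
Unset Strict Implicit.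
Unset Printing Implicit Defensive.

Record sgraph := SGraph {
  svertex :> finType;
  sedge : rel svertex;
  sedge_sym : symmetric sedge;
  sedge_irrefl : irreflexive sedge
}.

Definition connected (G : sgraph) : Prop :=
  0 < #|G| /\ forall x y : G, connect (@sedge G) x y.

(* A simple graph has no cycle of length 1, and a [ucycle] of length 2 is an
   edge traversed back and forth. *)
Definition acyclic (G : sgraph) : Prop :=
  forall c : seq G, ucycle (@sedge G) c -> size c < 3.

Definition is_tree (G : sgraph) : Prop := connected G /\ acyclic G.

(* Shortest paths have fewer than #|G| edges; the default value #|G| is only
   reached by pairs of vertices in different components. *)
Definition dist (G : sgraph) (x y : G) : nat :=
  \big[minn/#|G|]_(n < #|G| |
     [exists p : n.-tuple G, path (@sedge G) x p && (last x p == y)]) n.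

Definition eccentricity (G : sgraph) (x : G) : nat := \max_(y : G) dist x y.

(* On a connected graph every eccentricity is less than the default #|G|. *)
Definition radius (G : sgraph) : nat :=
  \big[minn/#|G|]_(x : G) eccentricity x.

Definition isomorphic (G J : sgraph) : Prop :=
  exists f : G -> J,
    bijective f /\ forall x y : G, sedge (f x) (f y) = sedge x y.

Record subgraph (J : sgraph) := Subgraph {
  sub_verts : {set J};
  sub_edges : rel J;
  sub_edges_sym : symmetric sub_edges;
  sub_edgesP : forall x y : J, sub_edges x y ->
    [/\ x \in sub_verts, y \in sub_verts & sedge x y]
}.

Section SubgraphGraph.
Variables (J : sgraph) (S : subgraph J).

Definition subgraph_rel : rel {x : J | x \in sub_verts S} :=
  fun u v => sub_edges S (val u) (val v).

Lemma subgraph_rel_sym : symmetric subgraph_rel.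
Proof. by move=> u v; apply: sub_edges_sym. Qed.

Lemma subgraph_rel_irrefl : irreflexive subgraph_rel.
Proof.
by move=> u; apply/negP => /sub_edgesP[_ _]; rewrite sedge_irrefl.
Qed.

Definition graph_of_subgraph : sgraph :=
  SGraph subgraph_rel_sym subgraph_rel_irrefl.
End SubgraphGraph.

Definition contained (G J : sgraph) : Prop :=
  exists S : subgraph J, isomorphic G (graph_of_subgraph S).

(* [A] is nonempty and induces a connected subgraph of [G]. *)
Definition connected_set (G : sgraph) (A : {set G}) : Prop :=
  A != set0 /\
  {in A &, forall x y,
     connect [rel u v | [&& u \in A, v \in A & sedge u v]] x y}.

(* [T] is a minor of [G], given by the branch sets of a model of [T] in [G]. *)
Definition minor (T G : sgraph) : Prop :=
  exists B : T -> {set G},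
    [/\ forall a : T, connected_set (B a),
        forall a b : T, a != b -> [disjoint B a & B b]
      & forall a b : T, sedge a b ->
          exists x y : G, [/\ x \in B a, y \in B b & sedge x y]].

Definition path_decomposition (G : sgraph) (s : seq {set G}) : Prop :=
  [/\ forall x : G, exists2 B, B \in s & x \in B,
      forall x y : G, sedge x y -> exists2 B, B \in s & (x \in B) && (y \in B)
    & forall (x : G) (i j k : nat), i <= j <= k -> k < size s ->
        x \in nth set0 s i -> x \in nth set0 s k -> x \in nth set0 s j].

(* With truncated predecessor, the width is 0 instead of -1 when all bags are
   empty, which only happens for the graph without vertices. *)
Definition width (G : sgraph) (s : seq {set G}) : nat :=
  (\max_(B <- s) #|B|).-1.

Lemma path_decomposition_setT (G : sgraph) :
  path_decomposition [:: [set: G]].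
Proof.
split=> [x|x y _|x i j k /andP[_ jk]].
- by exists setT; rewrite ?inE.
- by exists setT; rewrite ?inE.
- by rewrite ltnS leqn0 => /eqP k0; move: jk; rewrite k0 leqn0 => /eqP ->.
Qed.

Lemma ex_width (G : sgraph) :
  exists k, `[< exists2 s : seq {set G}, path_decomposition s & width s = k >].
Proof.
exists (width [:: [set: G]]); apply/asboolP.
by exists [:: [set: G]] => //; apply: path_decomposition_setT.
Qed.

Definition pathwidth (G : sgraph) : nat := ex_minn (ex_width G).

Section Complete.
Variable c : nat.

Definition complete_rel : rel 'I_c := fun i j => i != j.

Lemma complete_rel_sym : symmetric complete_rel.
Proof. by move=> i j; rewrite /complete_rel eq_sym. Qed.

Lemma complete_rel_irrefl : irreflexive complete_rel.
Proof. by move=> i; rewrite /complete_rel eqxx. Qed.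

Definition complete_graph : sgraph :=
  SGraph complete_rel_sym complete_rel_irrefl.
End Complete.

Section StrongProduct.
Variables G H : sgraph.

Definition strong_product_rel : rel (G * H) := fun p q =>
  [&& p != q,
      (p.1 == q.1) || sedge p.1 q.1
    & (p.2 == q.2) || sedge p.2 q.2].

Lemma strong_product_rel_sym : symmetric strong_product_rel.
Proof.
move=> p q; rewrite /strong_product_rel (eq_sym p) (eq_sym p.1) (eq_sym p.2).
by rewrite (sedge_sym p.1) (sedge_sym p.2).
Qed.

Lemma strong_product_rel_irrefl : irreflexive strong_product_rel.
Proof. by move=> p; rewrite /strong_product_rel eqxx. Qed.

Definition strong_product : sgraph :=
  SGraph strong_product_rel_sym strong_product_rel_irrefl.
End StrongProduct.

(* Main.v *)
Require Import Defs.
From HB Require Import structures.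
From mathcomp Require Import all_boot.
From mathcomp Require Import boolp zify.

Set Implicit Arguments.
Unset Strict Implicit.
Unset Printing Implicit Defensive.

(* Root T at a center.  By induction on h one shows: if C is connected, a is in C,
   and C has no partition into parts of size at most t - 2 whose quotient has a path
   decomposition with 2h parts per bag, then C contains a model of every rooted tree
   of height at most h on at most t vertices whose root branch set contains a.

   Given h >= 1, sweep C by a growing connected set P starting from {a}.  If the
   part Y outside P contained disjoint models of the subtrees below the children of
   the root, all rooted at neighbours of P, then P would serve as root branch set.
   So, as shown below, Y contains a set S of at most t - 2 vertices and a set Z that
   decomposes with 2(h - 1) parts per bag, such that all neighbours of Z in Y lie in
   Z or S, and all neighbours of P in Y lie in Z or S.  Take S as the next part: the
   bags for Z, with S and the previous such part added, have 2h parts.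

   To find Z and S, the subtrees are embedded one after the other as in the proof of
   Bienstock, Robertson, Seymour and Thomas: a partial model is kept with one
   vertex of S in each branch set, for a separation (Z, S) that is maximal with |S|
   equal to the number of branch sets and Z decomposable, and Menger's theorem moves
   the branch sets forward when (Z, S) grows.  When the embedding is stuck at s in
   S, maximality says that Z + s is not decomposable, so induction on h provides the
   whole subtree at once. *)

(** * Connected sets and Menger's theorem *)

Lemma disjoint_setUl (T : finType) (A B C : {set T}) :
  [disjoint A :|: B & C] = [disjoint A & C] && [disjoint B & C].
Proof. by rewrite -!setI_eq0 setIUl setU_eq0. Qed.

Section ConnectedSets.
Variable G : sgraph.
Implicit Types (A B C D E Q R S U Y Z : {set G}) (x y : G).

Definition inner_rel U : rel G := [rel u v | [&& u \in U, v \in U & sedge u v]].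

Lemma inner_rel_sym U : symmetric (inner_rel U).
Proof. by move=> x y; rewrite /inner_rel /= (@sedge_sym G x) andbCA. Qed.

Definition closed_in U R : Prop :=
  forall x y, x \in R -> y \in U -> sedge x y -> y \in R.

Lemma closed_in_connect U R x y :
  closed_in U R -> connect (inner_rel U) x y -> x \in R -> y \in R.
Proof.
move=> cR /connectP[q qP ->]; elim: q x qP => //= z q IH x.
by case/andP=> /and3P[_ zU xz] qP xR; apply: IH qP _; apply: cR xz.
Qed.

(** Closure under adjacency replaces paths from here on: inclusions of connected sets are proved by
    exhibiting one common vertex and a closed superset. *)
Lemma connected_setP A :
  connected_set A <->
  exists2 x, x \in A & forall R, x \in R -> closed_in A R -> A \subset R.
Proof.
split=> [[/set0Pn[x xA] cA]|[x xA cA]].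
  exists x => // R xR cR; apply/subsetP=> y yA.
  exact: closed_in_connect cR (cA x y xA yA) xR.
split; first by apply/set0Pn; exists x.
have xc y : y \in A -> connect (inner_rel A) x y.
  move=> yA; have /subsetP/(_ y yA) : A \subset [set y | connect (inner_rel A) x y].
    apply: cA; first by rewrite inE.
    move=> u v; rewrite !inE => xu vA uv; apply: (connect_trans xu).
    case: (boolP (u \in A)) => uA; first by apply: connect1; rewrite /inner_rel /= uA vA.
    by case/negP: uA; apply: (closed_in_connect _ xu xA).
  by rewrite inE.
move=> y z yA zA; apply: (connect_trans _ (xc z zA)).
by rewrite (sym_connect_sym (inner_rel_sym A)); apply: xc.
Qed.

Lemma connected_set_sub A R x :
  connected_set A -> x \in A -> x \in R -> closed_in A R -> A \subset R.
Proof.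
move=> [_ cA] xA xR cR; apply/subsetP=> y yA.
exact: closed_in_connect cR (cA x y xA yA) xR.
Qed.

Lemma connected_set1 x : connected_set [set x].
Proof.
apply/connected_setP; exists x => [|R xR _]; rewrite ?set11 //.
by rewrite sub1set.
Qed.

Lemma connected_setU_edge A B x y :
  connected_set A -> connected_set B -> x \in A -> y \in B ->
  (x == y) || sedge x y -> connected_set (A :|: B).
Proof.
move=> cA cB xA yB xy; apply/connected_setP; exists x; first by rewrite inE xA.
move=> R xR cR.
have AR : A \subset R.
  apply: (connected_set_sub cA xA xR) => u v uR vA; apply: cR uR _.
  by rewrite inE vA.
have yR : y \in R.
  by case/orP: xy => [/eqP <-//|]; apply: cR => //; rewrite inE yB orbT.
rewrite subUset AR; apply: (connected_set_sub cB yB yR) => u v uR vB.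
by apply: cR uR _; rewrite inE vB orbT.
Qed.

Lemma connected_setU_meet A B x :
  connected_set A -> connected_set B -> x \in A -> x \in B ->
  connected_set (A :|: B).
Proof.
by move=> cA cB xA xB; apply: (connected_setU_edge cA cB xA xB); rewrite eqxx.
Qed.

Definition component U x : {set G} := [set y | connect (inner_rel U) x y].

Lemma mem_component U x : x \in component U x.
Proof. by rewrite inE. Qed.

Lemma component_sub U x : x \in U -> component U x \subset U.
Proof.
move=> xU; apply/subsetP=> y; rewrite inE => xy.
by apply: (closed_in_connect _ xy xU).
Qed.

Lemma component_closed U x : x \in U -> closed_in U (component U x).
Proof.
move=> xU u v uC vU uv; have uU := subsetP (component_sub xU) u uC.
move: uC; rewrite !inE => xu; apply: connect_trans xu _.
by apply: connect1; rewrite /inner_rel /= uU vU.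
Qed.

Lemma component_connected U x : x \in U -> connected_set (component U x).
Proof.
move=> xU; apply/connected_setP; exists x; first exact: mem_component.
move=> R xR cR; apply/subsetP=> y; rewrite inE => xy.
have : y \in R :&: component U x.
  apply: (closed_in_connect (U := U) _ xy); last by rewrite inE xR mem_component.
  move=> u v /setIP[uR uC] vU uv.
  have vC := component_closed xU uC vU uv.
  by rewrite inE vC andbT; apply: cR uR _ uv.
by case/setIP.
Qed.

(* [D] is the component of [b] in [E] minus [C], plus one vertex of [C]. *)
Lemma connected_approach E C b :
  connected_set E -> b \in E -> E :&: C != set0 ->
  exists D a, [/\ connected_set D, D \subset E, b \in D, a \in D & D :&: C = [set a]].
Proof.
move=> cE bE /set0Pn[s /setIP[sE sC]].
case: (boolP (b \in C)) => bC.
  exists [set b], b; split; rewrite ?set11 ?sub1set //; first exact: connected_set1.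
  by apply/setIidPl; rewrite sub1set.
have bEC : b \in E :\: C by rewrite inE bC.
pose D := component (E :\: C) b.
have DEC : D \subset E :\: C := component_sub bEC.
have [/existsP[u /existsP[a /and4P[uD aE aC ua]]]|nex] :=
  boolP [exists u, exists a, [&& u \in D, a \in E, a \in C & sedge u a]].
  exists (D :|: [set a]), a; split.
  - apply: (connected_setU_edge (component_connected bEC) (connected_set1 a) uD (set11 a)).
    by rewrite ua orbT.
  - rewrite subUset sub1set aE andbT; apply: subset_trans DEC _; exact: subsetDl.
  - by rewrite inE mem_component.
  - by rewrite inE set11 orbT.
  apply/setP=> z; rewrite !inE; case: eqP => [->|_]; first by rewrite orbT aC.
  rewrite orbF; apply/negP=> /andP[zD zC].
  have /(subsetP DEC) : z \in D by rewrite inE.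
  by rewrite inE zC.
have /subsetP/(_ s sE) : E \subset D.
  apply: (connected_set_sub cE bE (mem_component _ _)) => u v uD vE uv.
  apply: (component_closed bEC uD) => //; rewrite inE vE andbT.
  apply/negP=> vC; case/negP: nex; apply/existsP; exists u; apply/existsP; exists v.
  by rewrite uD vE vC.
by move/(subsetP DEC); rewrite inE sC.
Qed.

Definition separation U R Q : Prop :=
  forall x y, x \in R -> y \in U -> sedge x y -> y \in R :|: Q.

(** Menger's condition without paths. [R] contains all that can be reached from [A] in [U] while
    avoiding [Q], so a pair [R], [Q] as here certifies that [Q] separates [A] from [B]. *)
Definition linked U A B : Prop :=
  forall R Q, R \subset U -> Q \subset U -> A \subset R :|: Q ->
    [disjoint R & B] -> separation U R Q -> #|A| <= #|Q|.

(** Connected sets stand in for disjoint paths, as they only serve to enlarge branch sets. *)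
Definition linkage U A B (P : G -> {set G}) : Prop :=
  (forall a, a \in A ->
     [/\ connected_set (P a), P a \subset U, a \in P a & P a :&: B != set0]) /\
  {in A &, forall a a', a != a' -> [disjoint P a & P a']}.

(** [P1 a] is prolonged by the set of [P2] that starts at [q a], a vertex of [Q] in [P1 a]. As [Q]
    has the size of [A], [q] maps [A] onto [Q], so [P1 a] meets [U2] at most in [q a]. *)
Lemma linkage_comp U U1 U2 A B Q P1 P2 :
  U1 \subset U -> U2 \subset U -> U1 :&: U2 \subset Q -> #|Q| = #|A| ->
  linkage U1 A Q P1 -> linkage U2 Q B P2 -> exists P, linkage U A B P.
Proof.
move=> U1U U2U U12 QA [P1P P1d] [P2P P2d].
pose q a := odflt a [pick x in P1 a :&: Q].
have qP a : a \in A -> q a \in P1 a /\ q a \in Q.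
  move=> aA; rewrite /q; case: pickP => [x /setIP[]//|/= n0].
  by have [_ _ _ /set0Pn[x]] := P1P a aA; rewrite n0.
have P1inj a a' x : a \in A -> a' \in A -> x \in P1 a -> x \in P1 a' -> a = a'.
  move=> aA a'A xa xa'; apply/eqP; apply: contraT => /(P1d _ _ aA a'A).
  by move/disjointFr=> /(_ _ xa); rewrite xa'.
have P2inj a a' x : a \in Q -> a' \in Q -> x \in P2 a -> x \in P2 a' -> a = a'.
  move=> aA a'A xa xa'; apply/eqP; apply: contraT => /(P2d _ _ aA a'A).
  by move/disjointFr=> /(_ _ xa); rewrite xa'.
have qinj : {in A &, injective q}.
  move=> a a' aA a'A e; have [h1 _] := qP a aA; have [h2 _] := qP a' a'A.
  by apply: (P1inj _ _ (q a)) => //; rewrite e.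
have qA : q @: A = Q.
  apply/eqP; rewrite eqEcard card_in_imset // QA leqnn andbT.
  by apply/subsetP=> _ /imsetP[a aA ->]; case: (qP a aA).
have qU a x : a \in A -> x \in P1 a -> x \in U2 -> x = q a.
  move=> aA xa x2; have [_ /subsetP s1 _ _] := P1P a aA.
  have : x \in Q by apply: (subsetP U12); rewrite inE s1.
  rewrite -qA => /imsetP[a' a'A xq]; rewrite xq; congr q.
  by apply: (P1inj _ _ x) => //; rewrite xq; case: (qP a' a'A).
exists (fun a => P1 a :|: P2 (q a)); split=> [a aA|a a' aA a'A naa'].
  have [c1 s1 a1 _] := P1P a aA; have [q1 qQ] := qP a aA.
  have [c2 s2 a2 /set0Pn[z /setIP[z2 zB]]] := P2P _ qQ; split.
  - exact: connected_setU_meet c1 c2 q1 a2.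
  - by rewrite subUset (subset_trans s1 U1U) (subset_trans s2 U2U).
  - by rewrite inE a1.
  - by apply/set0Pn; exists z; rewrite !inE z2 zB orbT.
have [q1 qQ] := qP a aA; have [q1' qQ'] := qP a' a'A.
have [_ /subsetP s2 a2 _] := P2P _ qQ; have [_ /subsetP s2' a2' _] := P2P _ qQ'.
rewrite -setI_eq0; apply/eqP/setP=> x; rewrite !inE; apply/negP=> /andP[].
case/orP=> h /orP[] h'; case/eqP: naa'.
- exact: P1inj h h'.
- apply: qinj => //; have e := qU _ _ aA h (s2' _ h').
  by apply: (P2inj _ _ x) => //; rewrite e.
- apply: qinj => //; have e := qU _ _ a'A h' (s2 _ h).
  by apply: (P2inj _ _ x) => //; rewrite e.
- by apply: qinj => //; apply: P2inj h h'.
Qed.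

(* Replace [a] in [A] by a neighbour [u]; if this destroys
   linkedness, the obstruction together with [a] is a minimum separator, which
   either splits [U] into two smaller instances or shows that [u] is useless. *)
Theorem menger U A B : A \subset U -> linked U A B -> exists P, linkage U A B P.
Proof.
have [n] := ubnP #|U|; elim: n => // n IH in U A B *; rewrite ltnS => Un AU lk.
have [AB|/subsetPn[a aA aB]] := boolP (A \subset B).
  exists (fun x => [set x]); split=> [a aA|a a' _ _ naa'].
    split; rewrite ?set11 ?sub1set ?(subsetP AU) //; first exact: connected_set1.
    by apply/set0Pn; exists a; rewrite !inE eqxx (subsetP AB).
  by rewrite disjoints1 inE.
have aU := subsetP AU a aA.
(* If [a] had no neighbour in [U] outside [A], then [A :\ a] would be a separator that is too small,
   with [R] equal to [[set a]]. *)
have [u [uU uA au]] : exists u, [/\ u \in U, u \notin A & sedge a u].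
  apply: contrapT => nu.
  suff: #|A| <= #|A :\ a| by rewrite (cardsD1 a A) aA ltnn.
  apply: (lk [set a]); rewrite ?sub1set ?disjoints1 //.
  - exact: subset_trans (subsetDl _ _) AU.
  - by rewrite setD1K.
  - move=> x y /set1P -> yU ay; rewrite setD1K //.
    by apply: contrapT => /negP yA; apply: nu; exists y.
have uDa : u != a by apply: contraNneq uA => ->.
pose U' := U :\ a; pose A' := u |: A :\ a.
have cA' : #|A'| = #|A|.
  by rewrite cardsU1 !inE uDa (negPf uA) (cardsD1 a A) aA.
have subU' : U' \subset U := subsetDl _ _.
have U'n : #|U'| < n by rewrite (leq_trans _ Un) // (cardsD1 a U) aU.
have [lk'|nlk] := pselect (linked U' A' B).
  have A'U' : A' \subset U'.
    by rewrite subUset sub1set !inE uDa uU setSD.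
  have [P [PP Pd]] := IH _ _ _ U'n A'U' lk'.
  have uA' : u \in A' by rewrite setU11.
  have inA' x : x \in A -> x != a -> x \in A' by move=> xA xa; rewrite !inE xa xA orbT.
  have aP x : x \in A' -> a \notin P x.
    by move=> /PP[_ /subsetP s _ _]; apply/negP=> /s; rewrite !inE eqxx.
  exists (fun x => if x == a then [set a] :|: P u else P x); split=> [x xA|x y xA yA nxy].
    case: eqP => [->|/eqP xa].
      have [cu su uu /set0Pn[z /setIP[zP zB]]] := PP u uA'; split.
      - by apply: (connected_setU_edge (connected_set1 a) cu (set11 a) uu); rewrite au orbT.
      - by rewrite subUset sub1set aU (subset_trans su).
      - by rewrite setU11.
      - by apply/set0Pn; exists z; rewrite !inE zP zB orbT.
    have [cu su uu mu] := PP x (inA' x xA xa); split => //; exact: subset_trans su _.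
  have uN z : z \in A -> u != z by move=> zA; apply: contraNneq uA => ->.
  have [xa|xa] := eqVneq x a; have [ya|ya] := eqVneq y a.
  - by rewrite xa ya eqxx in nxy.
  - rewrite disjoint_setUl disjoints1 aP ?inA' //=.
    by apply: Pd => //; [apply: inA' | apply: uN].
  - rewrite disjoint_sym disjoint_setUl disjoints1 aP ?inA' //=.
    by apply: Pd => //; [apply: inA' | apply: uN].
  - by apply: Pd; rewrite ?inA'.
have [R [Q [RU' QU' A'RQ RB [sRQ QA]]]] : exists R Q, [/\ R \subset U', Q \subset U',
    A' \subset R :|: Q, [disjoint R & B] & separation U' R Q /\ #|Q| < #|A|].
  apply: contrapT => nex; apply: nlk => R Q RU QU ARQ RB sep.
  rewrite leqNgt cA'; apply/negP=> lt; apply: nex; exists R, Q; split=> //.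
pose Q1 := a |: Q; pose R1 := R :\: Q1.
have RU : R \subset U by apply: subset_trans RU' _.
have Q1U : Q1 \subset U by rewrite subUset sub1set aU (subset_trans QU').
have ARQ1 : A \subset R :|: Q1.
  apply/subsetP=> x xA; rewrite !inE; have [//|xa] := eqVneq x a; first by rewrite orbT.
  have xA' : x \in A' by rewrite !inE xa xA orbT.
  by have := subsetP A'RQ x xA'; rewrite inE.
have sep1 : separation U R Q1.
  move=> x y xR yU xy; rewrite !inE; have [ya|ya] := eqVneq y a; first by rewrite orbT.
  by have := sRQ x y xR _ xy; rewrite !inE ya yU => /(_ isT).
have cQ1 : #|Q1| = #|A|.
  apply/eqP; rewrite eqn_leq (lk R Q1) // andbT cardsU1.
  by apply: leq_trans QA; case: (a \in Q).
have RQ1 : R1 :|: Q1 = R :|: Q1.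
  by apply/setP=> x; rewrite !inE; case: (x == a); case: (x \in Q); rewrite ?orbT ?orbF.
(* If the separator is [A] itself, then [u] lies behind it, in [R], and can be deleted: adding [R]
   to the first side of a separation of [U :\ u] gives one of [U]. *)
have [Q1A|Q1A] := eqVneq Q1 A.
  have uR : u \in R.
    have /(subsetP A'RQ) : u \in A' by rewrite setU11.
    rewrite inE => /orP[//|uQ]; case/negP: uA; rewrite -Q1A inE uQ orbT //.
  have Uu : #|U :\ u| < n by rewrite (leq_trans _ Un) // (cardsD1 u U) uU.
  have AUu : A \subset U :\ u by rewrite subsetD1 AU.
  have [|P [PP Pd]] := IH _ _ B Uu AUu.
    move=> R2 Q2 R2U Q2U AR2 R2B s2; apply: (lk (R2 :|: R)) => //.
    - by rewrite subUset RU (subset_trans R2U) // subsetDl.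
    - by rewrite (subset_trans Q2U) // subsetDl.
    - by rewrite setUAC (subset_trans AR2) // subsetUl.
    - by rewrite disjoint_setUl R2B.
    - move=> x y; rewrite !inE => /orP[xR|xR] yU xy.
        have [->|yu] := eqVneq y u; first by rewrite uR orbT.
        by have := s2 x y xR _ xy; rewrite !inE yu yU => /(_ isT) /orP[] ->; rewrite ?orbT.
      have := sep1 x y xR yU xy; rewrite Q1A inE => /orP[->|/(subsetP AR2)]; rewrite ?orbT //.
      by rewrite inE => /orP[] ->; rewrite ?orbT.
  exists P; split=> // x xA; have [h1 h2 h3 h4] := PP x xA; split=> //.
  by rewrite (subset_trans h2) // subsetDl.
pose U1 := R :|: Q1; pose U2 := U :\: R1.
have U1U : U1 \subset U by rewrite subUset RU.
have U2U : U2 \subset U := subsetDl _ _.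
have Q1U2 : Q1 \subset U2.
  by apply/subsetP=> x xQ; rewrite !in_setD xQ /= (subsetP Q1U).
have R1R : R1 \subset R := subsetDl _ _.
(* If [U1] were all of [U], then [U :&: B] would lie in [Q1] and, by linkedness, equal it; but [a]
   is in [Q1] and not in [B]. *)
have U1n : #|U1| < n.
  apply: leq_trans Un; apply: proper_card; rewrite properEneq U1U andbT.
  apply: contraNneq aB => U1E; suff: U :&: B = Q1.
    by move=> e; have : a \in Q1 := setU11 _ _; rewrite -e => /setIP[].
  apply/eqP; rewrite eqEcard; apply/andP; split.
    apply/subsetP=> x /setIP[]; rewrite -U1E inE => /orP[xR xB|//].
    by rewrite (disjointFr RB xR) in xB.
  rewrite cQ1; apply: (lk (U :\: B)); rewrite ?subsetDl ?subsetIl //.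
  - by rewrite setUC setID.
  - by rewrite disjoints_subset setDE subsetIr.
  - by move=> x y _ yU _; rewrite setUC setID.
(* If nothing were removed from [U], then [A] would lie in [Q1] and equal it, the case treated
   above. *)
have U2n : #|U2| < n.
  apply: leq_trans Un; apply: proper_card; rewrite properEneq U2U andbT.
  apply: contraNneq Q1A => U2E; rewrite eq_sym eqEcard cQ1 leqnn andbT.
  apply/subsetP=> x xA; have := subsetP ARQ1 x xA; rewrite -RQ1 inE => /orP[xR1|//].
  by have := subsetP AU x xA; rewrite -U2E inE xR1.
have [|P1 P1P] := IH U1 A Q1 U1n ARQ1.
  move=> R2 Q2 R2U Q2U AR2 R2Q s2.
  have R2R x : x \in R2 -> x \in R.
    by move=> xR; have := subsetP R2U x xR; rewrite inE (disjointFr R2Q xR) orbF.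
  apply: (lk R2) => //; try exact: subset_trans U1U.
    apply: disjointWl RB; apply/subsetP; exact: R2R.
  by move=> x y xR yU xy; apply: s2 (xy) => //; apply: sep1 xy => //; apply: R2R.
have [|P2 P2P] := IH U2 Q1 B U2n Q1U2.
  move=> R2 Q2 R2U Q2U QR2 R2B s2; rewrite cQ1.
  apply: (lk (R1 :|: R2)); rewrite ?subUset ?(subset_trans R1R) ?(subset_trans R2U) //.
  - exact: subset_trans U2U.
  - rewrite (subset_trans ARQ1) // -RQ1 -setUA; exact: setUS.
  - by rewrite disjoint_setUl R2B (disjointWl R1R).
  - move=> x y; rewrite inE => /orP[xR|xR] yU xy.
      have := sep1 x y (subsetP R1R x xR) yU xy; rewrite -RQ1 -setUA.
      by apply: subsetP; apply: setUS.
    case: (boolP (y \in R1)) => yR; first by rewrite 2!inE yR.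
    by rewrite -setUA inE (s2 x y) ?orbT // in_setD yR.
apply: (linkage_comp U1U U2U _ cQ1 P1P P2P).
rewrite /U1 -RQ1; apply/subsetP=> x; rewrite in_setI in_setU => /andP[/orP[xR|//]].
by rewrite /U2 in_setD xR.
Qed.

End ConnectedSets.

(** * Models of rooted trees *)

Section Descendants.
Variables (V : finType) (p : V -> V) (lev : V -> nat).
Hypothesis lev_parent : forall v, p v != v -> lev v = (lev (p v)).+1.

(** Roots are the fixed points of [p], which keeps [p] total; this set is the subtree hanging from
    [v]. *)
Definition desc (v : V) : {set V} := [set w | fconnect p w v].

Lemma desc_refl v : v \in desc v.
Proof. by rewrite inE. Qed.

Lemma desc_iter v w : w \in desc v -> exists n, iter n p w = v.
Proof. by rewrite inE => /iter_findex <-; eexists. Qed.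

Lemma desc_of_parent v w : p w \in desc v -> w \in desc v.
Proof. by rewrite !inE; apply: connect_trans; apply: fconnect1. Qed.

Lemma lev_parent_leq v : lev (p v) <= lev v.
Proof. by have [->//|/lev_parent ->] := eqVneq (p v) v. Qed.

Lemma desc_lev v w : w \in desc v -> lev v <= lev w.
Proof.
case/desc_iter=> n <-; elim: n => //= n IH.
exact: leq_trans (lev_parent_leq _) IH.
Qed.

Lemma desc_parent v w : w \in desc v -> w != v -> p w != w /\ p w \in desc v.
Proof.
case/desc_iter=> [[/= ->|n]]; first by rewrite eqxx.
rewrite iterSr => wv nwv; split; last by rewrite inE -wv fconnect_iter.
apply: contraNneq nwv => pw; rewrite -wv pw.
by elim: n {wv} => //= n IH; rewrite -(eqP IH) pw.
Qed.

Lemma parent_notin_desc v : p v != v -> p v \notin desc v.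
Proof. by move=> pv; apply/negP=> /desc_lev; rewrite (lev_parent pv) ltnn. Qed.

Definition children (v : V) : {set V} := [set c | (p c == v) && (c != v)].

Lemma childrenP v c : c \in children v -> p c = v /\ p c != c.
Proof. by rewrite inE => /andP[/eqP -> cv]; rewrite eq_sym. Qed.

Lemma desc_childE v w :
  w \in desc v -> w != v -> exists2 c, c \in children v & w \in desc c.
Proof.
have [n] := ubnP (lev w); elim: n => // n IH in w *; rewrite ltnS => lw wv nwv.
have [pw pwv] := desc_parent wv nwv.
have [e|ne] := eqVneq (p w) v.
  by exists w; rewrite ?desc_refl // inE e eqxx.
have [|c cv pc] := IH (p w) _ pwv ne; first by move: lw; rewrite (lev_parent pw).
by exists c => //; apply: desc_of_parent.
Qed.

Lemma desc_child_sub v c w : c \in children v -> w \in desc c -> w \in desc v.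
Proof.
move=> /childrenP[<- _]; rewrite !inE => wc; apply: connect_trans wc _.
exact: fconnect1.
Qed.

Lemma desc_child_neq v c w : c \in children v -> w \in desc c -> w != v.
Proof.
move=> /childrenP[<- pc] wc; apply: contraNneq (parent_notin_desc pc) => <-.
exact: wc.
Qed.

(** Both children are iterates of [p] at [w]. If one came strictly later than the other, it would be
    an ancestor of its own parent [v]. *)
Lemma desc_children_disjoint v c c' w :
  c \in children v -> c' \in children v -> w \in desc c -> w \in desc c' -> c = c'.
Proof.
have main c1 c2 n m : c1 \in children v -> c2 \in children v ->
    n <= m -> iter n p w = c1 -> iter m p w = c2 -> c1 = c2.
  move=> h1 h2 nm e1; rewrite -(subnK nm) iterD e1.
  case: (m - n) => [//|k]; rewrite iterSr.
  have [p1 _] := childrenP h1; have [p2 n2] := childrenP h2; rewrite p1 => e.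
  have /negP[] := parent_notin_desc n2.
  by rewrite p2 inE -e fconnect_iter.
move=> h1 h2 /desc_iter[n e1] /desc_iter[m e2].
by case: (leqP n m) => [|/ltnW] nm; [|symmetry]; apply: main nm _ _.
Qed.

Section Models.
Variable G : sgraph.
Implicit Types (W : {set V}) (B C D E Q R S U Y Z : {set G}) (beta : V -> {set G}).

Definition top W w := (p w == w) || (p w \notin W).

(* Branch sets for the vertices of [W], joined along the parent edges inside
   [W]; the topmost vertices of [W] are rooted in [B]. *)
Definition model W U B beta : Prop :=
  [/\ forall w, w \in W -> connected_set (beta w) /\ beta w \subset U,
      {in W &, forall w w', w != w' -> [disjoint beta w & beta w']},
      forall w, w \in W -> top W w -> beta w :&: B != set0
    & forall w, w \in W -> ~~ top W w ->
        exists x y, [/\ x \in beta w, y \in beta (p w) & sedge x y]].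

Lemma model_sub W U U' B beta : U \subset U' -> model W U B beta -> model W U' B beta.
Proof.
by move=> UU' [h1 h2 h3 h4]; split=> // w /h1[cw wU]; split=> //; apply: subset_trans UU'.
Qed.

Lemma top_sub W W' w : W \subset W' -> top W' w -> top W w.
Proof. by move=> /subsetP s; rewrite /top => /orP[->//|h]; rewrite (contra (s _) h) orbT. Qed.

(** The hypotheses on topmost vertices say that no parent edge joins [W1] and [W2], so no adjacency
    between the two models is called for. *)
Lemma model_union W1 W2 U1 U2 B beta1 beta2 :
  [disjoint U1 & U2] -> [disjoint W1 & W2] ->
  (forall w, w \in W1 -> top W1 w -> top (W1 :|: W2) w) ->
  (forall w, w \in W2 -> top W2 w -> top (W1 :|: W2) w) ->
  model W1 U1 B beta1 -> model W2 U2 B beta2 ->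
  exists beta, model (W1 :|: W2) (U1 :|: U2) B beta.
Proof.
move=> dU dW t1 t2 [a1 a2 a3 a4] [b1 b2 b3 b4].
pose beta w := if w \in W1 then beta1 w else beta2 w.
have E1 w : w \in W1 -> beta w = beta1 w by rewrite /beta => ->.
have E2 w : w \in W2 -> beta w = beta2 w by move=> h; rewrite /beta (disjointFl dW h).
have pW W w : ~~ top W w -> p w \in W by rewrite negb_or negbK => /andP[].
exists beta; split=> [w|w w'|w|w].
- case/setUP=> h; rewrite ?(E1 _ h) ?(E2 _ h).
    by have [? s] := a1 w h; split=> //; apply: subset_trans s (subsetUl _ _).
  by have [? s] := b1 w h; split=> //; apply: subset_trans s (subsetUr _ _).
- case/setUP=> h /setUP[] h'; rewrite ?(E1 _ h) ?(E2 _ h) ?(E1 _ h') ?(E2 _ h') => n.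
  + exact: a2.
  + by have [_ s] := a1 w h; have [_ s'] := b1 w' h'; apply: disjointW s s' dU.
  + rewrite disjoint_sym.
    by have [_ s] := b1 w h; have [_ s'] := a1 w' h'; apply: disjointW s' s dU.
  + exact: b2.
- case/setUP=> h; rewrite ?(E1 _ h) ?(E2 _ h) => tw.
    by apply: a3 => //; apply: top_sub tw; apply: subsetUl.
  by apply: b3 => //; apply: top_sub tw; apply: subsetUr.
- case/setUP=> h; rewrite ?(E1 _ h) ?(E2 _ h) => tw.
    have tw1 := contra (t1 w h) tw; rewrite (E1 (p w) (pW _ _ tw1)); exact: a4.
  have tw1 := contra (t2 w h) tw; rewrite (E2 (p w) (pW _ _ tw1)); exact: b4.
Qed.

Lemma model_grow W U U' B beta gamma :
  model W U B beta -> U \subset U' ->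
  (forall w, w \in W -> [/\ connected_set (gamma w), gamma w \subset U' &
                            beta w \subset gamma w]) ->
  {in W &, forall w w', w != w' -> [disjoint gamma w & gamma w']} ->
  model W U' B gamma.
Proof.
move=> [h1 h2 h3 h4] UU' g1 g2; split=> // [w /g1[]//|w wW tw|w wW tw].
  have [_ _ s] := g1 w wW; have /set0Pn[x /setIP[xb xB]] := h3 w wW tw.
  by apply/set0Pn; exists x; rewrite inE xB (subsetP s).
have [x [y [xb yb xy]]] := h4 w wW tw.
have pW : p w \in W by move: tw; rewrite negb_or negbK => /andP[].
have [_ _ s] := g1 w wW; have [_ _ s'] := g1 _ pW.
by exists x, y; split=> //; [apply: (subsetP s)|apply: (subsetP s')].
Qed.

(** * Maximal separations and partial models *)

Definition sep_in Y Z S : Prop :=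
  [/\ Z \subset Y, S \subset Y, [disjoint Z & S] & separation Y Z S].

(** Stands for decomposability with a fixed number of parts per bag; only the closure properties
    assumed here and below are used. *)
Variable good : {set G} -> Prop.
Hypothesis good_sub : forall Z Z', Z' \subset Z -> good Z -> good Z'.

(** Allowing every [S'] of size at most [#|S|] is what lets Menger's condition be derived in
    [relink]. *)
Definition maximal_sep Y Z S : Prop :=
  forall Z' S', sep_in Y Z' S' -> good Z' -> Z \subset Z' ->
    Z :|: S \subset Z' :|: S' -> #|S'| <= #|S| -> Z' = Z.

Lemma extend_to_maximal Y Z S : sep_in Y Z S -> good Z ->
  exists Z' S', [/\ sep_in Y Z' S', good Z' & maximal_sep Y Z' S'] /\
    [/\ Z \subset Z', Z :|: S \subset Z' :|: S' & #|S'| <= #|S|].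
Proof.
have [n] := ubnP (#|Y| - #|Z|); elim: n => // n IH in Z S * => lt sZ gZ.
have [m|nm] := pselect (maximal_sep Y Z S); first by exists Z, S.
have [Z' [S' [[sZ' gZ'] [ZZ' ZS SS] nZ]]] : exists Z' S',
    [/\ sep_in Y Z' S' /\ good Z',
        [/\ Z \subset Z', Z :|: S \subset Z' :|: S' & #|S'| <= #|S|] & Z' <> Z].
  apply: contrapT => nex; apply: nm => Z' S' h1 h2 h3 h4 h5.
  by apply: contrapT => h6; apply: nex; exists Z', S'.
have Zlt : #|Z| < #|Z'|.
  by apply: proper_card; rewrite properEneq ZZ' andbT; apply/eqP=> e; apply: nZ.
have leY : #|Z'| <= #|Y| by case: sZ' => /subset_leq_card.
have [|Z2 [S2 [h1 [h2 h3 h4]]]] := IH Z' S' _ sZ' gZ'; first by lia.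
exists Z2, S2; split=> //; split; last exact: leq_trans h4 SS.
- exact: subset_trans h2.
- exact: subset_trans h3.
Qed.

(** When the branch sets are disjoint, equal cardinality makes [sigma] a bijection from [W] to [S],
    so each branch set meets [S] in exactly one vertex. *)
Definition rooted_at S W beta (sigma : V -> G) : Prop :=
  #|S| = #|W| /\ forall w, w \in W -> sigma w \in beta w /\ sigma w \in S.

(** With [y] added to [S] the separation may cease to be maximal. It is pushed out to a maximal one,
    and the branch sets follow along a linkage from [y |: S] to [S'] outside [Z]. *)
Lemma relink Y B Z S y W beta sigma :
  sep_in Y Z S -> good Z -> maximal_sep Y Z S -> y \in Y -> y \notin Z :|: S ->
  model W (Z :|: (y |: S)) B beta -> rooted_at (y |: S) W beta sigma ->
  exists Z' S' beta' sigma',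
    [/\ sep_in Y Z' S', good Z', maximal_sep Y Z' S', model W (Z' :|: S') B beta'
      & rooted_at S' W beta' sigma'].
Proof.
move=> [ZY SY dZS sZS] gZ mZ yY yZS mod [cS sigP].
pose S1 := y |: S.
have yZ : y \notin Z by apply: contraNN yZS => h; rewrite inE h.
have yS : y \notin S by apply: contraNN yZS => h; rewrite inE h orbT.
have S1Y : S1 \subset Y by rewrite subUset sub1set yY.
have dZS1 : [disjoint Z & S1].
  by rewrite disjoint_sym disjoint_setUl disjoints1 yZ disjoint_sym.
have sZS1 : separation Y Z S1.
  move=> u v uZ vY uv; have := sZS u v uZ vY uv; rewrite !inE.
  by case/orP=> ->; rewrite ?orbT.
have SS1 : S \subset S1 := subsetUr _ _.
have [Z' [S' [[sZ' gZ' mZ'] [ZZ' ZS1 S'S1]]]] :=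
  extend_to_maximal (And4 ZY S1Y dZS1 sZS1) gZ.
have [Z'Y S'Y dZS' sep'] := sZ'.
pose U := (Z' :|: S') :\: Z.
have S1U : S1 \subset U.
  apply/subsetP=> x xS; rewrite in_setD (disjointFl dZS1 xS) /=.
  by apply: (subsetP ZS1); rewrite in_setU xS orbT.
have S'U : S' \subset U.
  apply/subsetP=> x xS; rewrite in_setD in_setU xS orbT andbT.
  by apply/negP=> /(subsetP ZZ'); rewrite (disjointFl dZS' xS).
have ZS'Y : Z' :|: S' \subset Y by rewrite subUset Z'Y.
(* A separator [Q] smaller than [S1] has at most [#|S|] vertices. Maximality of [Z] and [S] then
   forces [Z :|: (R :\: Q)] to be [Z], so [S1] lies in [Q], a contradiction. *)
have lk : linked U S1 S'.
  move=> R Q RU QU ARQ RS' sRQ; rewrite leqNgt; apply/negP=> lt.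
  have QS : #|Q| <= #|S| by move: lt; rewrite /S1 cardsU1 yS.
  have RZ' x : x \in R -> x \in Z'.
    move=> xR; have := subsetP RU x xR; rewrite in_setD in_setU (disjointFr RS' xR).
    by rewrite orbF => /andP[].
  have nQZ x : x \in Q -> x \notin Z.
    by move=> /(subsetP QU); rewrite in_setD => /andP[].
  have e : Z :|: (R :\: Q) = Z.
    apply: (mZ _ Q) => //.
    - split.
      + rewrite subUset ZY; apply/subsetP=> x /setDP[xR _].
        by apply: (subsetP Z'Y); apply: RZ'.
      + by apply: (subset_trans QU); apply: subset_trans ZS'Y; apply: subsetDl.
      + rewrite disjoint_setUl; apply/andP; split.
          by rewrite disjoint_sym disjoints_subset; apply/subsetP=> x /nQZ; rewrite inE.
        by rewrite disjoints_subset setDE subsetIr.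
      + move=> u v /setUP[uZ|/setDP[uR _]] vY uv.
          have := sZS1 u v uZ vY uv; case/setUP=> [h|/(subsetP ARQ)]; rewrite !inE ?h //.
          by case: (v \in Q); rewrite ?orbT //= orbF => ->; rewrite orbT.
        have vZS := sep' u v (RZ' u uR) vY uv.
        case: (boolP (v \in Z)) => vZ; first by rewrite !inE vZ.
        have : v \in R :|: Q by apply: sRQ uv => //; rewrite in_setD vZ.
        by rewrite !inE; case: (v \in Q); rewrite ?orbT //= orbF => ->; rewrite orbT.
    - apply: good_sub gZ'; rewrite subUset ZZ'; apply/subsetP=> x /setDP[xR _].
      exact: RZ'.
    - exact: subsetUl.
    - rewrite -setUA; apply: setUS; apply: subset_trans SS1 _.
      apply: subset_trans ARQ _; apply/subsetP=> x.
      by rewrite !inE; case: (x \in Q); rewrite ?orbT //= orbF => ->.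
  have S1Q : S1 \subset Q.
    apply/subsetP=> x xS; apply: contraT => xQ.
    have : x \in Z.
      rewrite -e; have := subsetP ARQ x xS; rewrite !inE (negPf xQ) orbF => ->.
      by rewrite orbT.
    by rewrite (disjointFl dZS1 xS).
  by have := subset_leq_card S1Q; rewrite leqNgt lt.
(* [S'] is itself a separator, hence no smaller than [S1]; so the linkage uses each vertex of [S']
   exactly once. *)
have cS' : #|S'| = #|S1|.
  apply/eqP; rewrite eqn_leq S'S1 /=; apply: (lk (U :\: S')) => //.
  - exact: subsetDl.
  - by rewrite setUC -{1}(setIidPr S'U) setID.
  - by rewrite disjoints_subset setDE subsetIr.
  - by move=> u v _ vU _; rewrite setUC -{1}(setIidPr S'U) setID.
have [P [PP Pd]] := menger S1U lk.
have [m1 m2 m3 m4] := mod.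
have binj w w' x : w \in W -> w' \in W -> x \in beta w -> x \in beta w' -> w = w'.
  move=> wW w'W xw xw'; apply/eqP; apply: contraT => /(m2 _ _ wW w'W).
  by move/disjointFr=> /(_ _ xw); rewrite xw'.
have Pinj a a' x : a \in S1 -> a' \in S1 -> x \in P a -> x \in P a' -> a = a'.
  move=> aA a'A xa xa'; apply/eqP; apply: contraT => /(Pd _ _ aA a'A).
  by move/disjointFr=> /(_ _ xa); rewrite xa'.
have sinj : {in W &, injective sigma}.
  move=> w w' wW w'W e; have [h _] := sigP w wW; have [h' _] := sigP w' w'W.
  by apply: (binj _ _ (sigma w)) => //; rewrite e.
have sW : sigma @: W = S1.
  apply/eqP; rewrite eqEcard card_in_imset // cS leqnn andbT.
  by apply/subsetP=> _ /imsetP[w wW ->]; case: (sigP w wW).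
have bS1 w x : w \in W -> x \in beta w -> x \in S1 -> x = sigma w.
  move=> wW xw; rewrite -sW => /imsetP[w' w'W e]; rewrite e; congr sigma.
  by apply: (binj _ _ x) => //; rewrite e; case: (sigP w' w'W).
(* The linkage avoids [Z], so it can meet [beta w] only in [S1], that is, in [sigma w]. *)
have bP w w' x : w \in W -> w' \in W -> x \in beta w -> x \in P (sigma w') -> w = w'.
  move=> wW w'W xw xP; have [h1 h2] := sigP w wW; have [h1' h2'] := sigP w' w'W.
  have [_ /subsetP PU sP' _] := PP _ h2'.
  have xS1 : x \in S1.
    have [_ /subsetP/(_ x xw)] := m1 w wW; have := PU x xP.
    by rewrite in_setD => /andP[/negPf nZ _]; rewrite in_setU nZ.
  apply: sinj => //; apply: (Pinj _ _ x) => //.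
  by rewrite (bS1 _ _ wW xw xS1); case: (PP _ h2).
pose sigma' w := odflt (sigma w) [pick x in P (sigma w) :&: S'].
have sP w : w \in W -> sigma' w \in P (sigma w) /\ sigma' w \in S'.
  move=> wW; rewrite /sigma'; case: pickP => [x /setIP[]//|/= n0].
  by have [_ h] := sigP w wW; have [_ _ _ /set0Pn[x]] := PP _ h; rewrite n0.
exists Z', S', (fun w => beta w :|: P (sigma w)), sigma'; split=> //.
  apply: (model_grow mod) => // [w wW|w w' wW w'W nw].
    have [h1 h2] := sigP w wW; have [cP sPU inP _] := PP _ h2; have [cb sb] := m1 w wW.
    split; last exact: subsetUl.
      exact: connected_setU_meet cb cP h1 inP.
    rewrite subUset (subset_trans sb ZS1) (subset_trans sPU) //; exact: subsetDl.
  rewrite -setI_eq0; apply/eqP/setP=> x; rewrite !inE; apply/negP=> /andP[].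
  have [_ h2] := sigP w wW; have [_ h2'] := sigP w' w'W.
  case/orP=> h /orP[] h'; case/eqP: nw.
  - exact: binj h h'.
  - exact: bP h h'.
  - by symmetry; apply: bP h' h.
  - by apply: sinj => //; apply: Pinj h h'.
split; first by rewrite cS' cS.
by move=> w wW; have [h1 h2] := sP w wW; rewrite inE h1 orbT.
Qed.


(** As [W] is closed under parents up to [c], only [c] can be topmost: the new vertex is either [c],
    to be rooted in [B], or hangs from a parent already modelled. *)
Lemma model_add c W U B beta w y :
  W \subset desc c -> (forall x, x \in W -> x != c -> p x \in W) ->
  w \in desc c -> w \notin W -> y \notin U -> model W U B beta ->
  (w = c /\ y \in B) \/
  [/\ w != c, p w \in W & exists2 s, s \in beta (p w) & sedge s y] ->
  model (w |: W) (y |: U) B (fun x => if x == w then [set y] else beta x).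
Proof.
move=> Wc dW wc wW yU [m1 m2 m3 m4] hw.
have wN x : x \in W -> (x == w) = false by move=> xW; apply: contraNF wW => /eqP <-.
have topc W' : W' \subset desc c -> top W' c.
  move=> sW; rewrite /top; have [//|pc /=] := eqVneq (p c) c.
  by apply: contraNN (parent_notin_desc pc); apply: (subsetP sW).
have yb x : x \in W -> [disjoint [set y] & beta x].
  by case/m1=> _ s; rewrite disjoints1; apply: contraNN yU; apply: (subsetP s).
have W1c : w |: W \subset desc c by rewrite subUset sub1set wc.
split=> [x|x x'|x|x].
- case/setU1P=> [->|xW]; rewrite ?eqxx ?wN //.
    by rewrite sub1set setU11; split=> //; apply: connected_set1.
  by have [? s] := m1 x xW; split=> //; apply: subset_trans s (subsetUr _ _).
- case/setU1P=> [->|xW] /setU1P[->|x'W]; rewrite ?eqxx ?wN // => n.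
  + exact: yb.
  + by rewrite disjoint_sym; apply: yb.
  + exact: m2.
- case/setU1P=> [->|xW]; rewrite ?eqxx ?wN //; last first.
    by move=> tx; apply: m3 => //; apply: top_sub tx; apply: subsetUr.
  case: hw => [[_ yB] _|[nwc pwW _]].
    by apply/set0Pn; exists y; rewrite !inE eqxx.
  have [pw _] := desc_parent wc nwc.
  by rewrite /top (negPf pw) !inE pwW orbT.
- case/setU1P=> [->|xW] nt; rewrite ?eqxx ?(wN _ xW).
    case: hw => [[wE _]|[nwc pwW [s sb sy]]]; first by rewrite {2}wE topc in nt.
    by rewrite wN //; exists y, s; rewrite set11 sedge_sym.
  have xc : x != c by apply: contraNneq nt => ->; rewrite topc.
  have pxW := dW x xW xc; rewrite (wN _ pxW); apply: m4 => //.
  by rewrite /top pxW orbF; case: (desc_parent (subsetP Wc x xW) xc).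
Qed.

(** The branch sets from [w] up to a topmost vertex form a connected union; it later carries a model
    found elsewhere back to [B]. *)
Lemma model_reach c W U B beta w :
  W \subset desc c -> (forall x, x \in W -> x != c -> p x \in W) ->
  model W U B beta -> w \in W ->
  exists E b, [/\ connected_set E, E \subset U, b \in E, b \in B & beta w \subset E].
Proof.
move=> Wc dW [m1 _ m3 m4].
have [n] := ubnP (lev w); elim: n => // n IH in w *; rewrite ltnS => lw wW.
have [cw sw] := m1 w wW.
case: (boolP (top W w)) => tw.
  by have /set0Pn[b /setIP[bw bB]] := m3 w wW tw; exists (beta w), b.
have [x [y [xw yp xy]]] := m4 w wW tw.
move: tw; rewrite negb_or negbK => /andP[pw pwW].
have [|E [b [cE EU bE bB pE]]] := IH (p w) _ pwW; first by rewrite (lev_parent pw) in lw.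
exists (E :|: beta w), b; split=> //; last exact: subsetUr.
- apply: (connected_setU_edge cE cw (subsetP pE y yp) xw).
  by rewrite sedge_sym xy orbT.
- by rewrite subUset EU.
- by rewrite inE bE.
Qed.

(** The root [c] is topmost, so [a] is in its branch set and the others avoid [D]. Hence [D] can be
    added to the root branch set to reach [B]. *)
Lemma model_reroot c U B C D a beta :
  model (desc c) C [set a] beta -> C \subset U -> D \subset U -> connected_set D ->
  D :&: B != set0 -> D :&: C = [set a] ->
  exists gamma, model (desc c) U B gamma.
Proof.
move=> [m1 m2 m3 m4] CU DU cD /set0Pn[b /setIP[bD bB]] DC.
have topc : top (desc c) c.
  rewrite /top; have [//|pc /=] := eqVneq (p c) c; exact: parent_notin_desc.
have /setIP[aD _] : a \in D :&: C by rewrite DC set11.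
have ac : a \in beta c.
  by have /set0Pn[x /setIP[xb /set1P <-]] := m3 c (desc_refl c) topc.
have Dd w : w \in desc c -> w != c -> [disjoint D & beta w].
  move=> wc nwc; rewrite -setI_eq0; apply/eqP/setP=> x; rewrite !inE.
  apply/negP=> /andP[xD xb]; have [_ /subsetP/(_ x xb) xC] := m1 w wc.
  have : x \in D :&: C by rewrite inE xD.
  rewrite DC => /set1P xa; have := m2 _ _ (desc_refl c) wc; rewrite eq_sym => /(_ nwc).
  by move/disjointFr=> /(_ _ ac); rewrite -xa xb.
exists (fun w => if w == c then beta c :|: D else beta w).
split=> [w wc|w w' wc w'c|w wc tw|w wc nt].
- have [cw sw] := m1 w wc; case: eqP => [e|_]; last first.
    by split=> //; apply: subset_trans CU.
  rewrite e in cw sw; split; first exact: connected_setU_meet cw cD ac aD.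
  by rewrite subUset DU (subset_trans sw).
- move=> n; have [we|nw] := eqVneq w c; have [we'|nw'] := eqVneq w' c.
  + by rewrite we we' eqxx in n.
  + by rewrite disjoint_setUl m2 ?desc_refl ?Dd // eq_sym.
  + by rewrite disjoint_sym disjoint_setUl m2 ?desc_refl ?Dd // eq_sym.
  + exact: m2.
- have [e|nw] := eqVneq w c; first by apply/set0Pn; exists b; rewrite !inE bD bB orbT.
  by have [pw pc] := desc_parent wc nw; move: tw; rewrite /top (negPf pw) pc.
- have nw : w != c by apply: contraNneq nt => ->.
  rewrite (negPf nw); have [x [y [xw yp xy]]] := m4 w wc nt.
  by exists x, y; split=> //; case: eqP => // e; rewrite -e inE yp.
Qed.

Hypothesis good0 : good set0.
Hypothesis bad_component :
  forall Z, ~ good Z -> exists C, [/\ C \subset Z, connected_set C & ~ good C].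

(** The induction hypothesis on the height, isolated so that the embedding does not depend on
    layouts. *)
Definition bad_has_model c : Prop :=
  forall C a, connected_set C -> a \in C -> ~ good C ->
    exists beta, model (desc c) C [set a] beta.

(* A prefix [W] of the tree below [c] is modelled in [Z :|: S] with exactly one
   vertex of [S] in each branch set.  If the branch set of the parent of the next
   vertex [w] cannot be extended, its vertex [s] in [S] has all its neighbours in
   [Z :|: S], so by maximality of the separation [s |: Z] is bad and already
   contains a model of the whole tree. *)
Lemma separation_or_model Y B c : bad_has_model c ->
  exists Z S, [/\ sep_in Y Z S, good Z, #|S| <= #|desc c| &
    (#|S| < #|desc c| /\ Y :&: B \subset Z :|: S) \/
    exists beta, model (desc c) (Z :|: S) B beta].
Proof.
move=> bad; set concl := (ex _).
(* Induction on the number of vertices below [c] not yet modelled. *)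
have grow n W Z S beta sigma : #|desc c| - #|W| < n ->
    W \subset desc c -> (forall x, x \in W -> x != c -> p x \in W) ->
    sep_in Y Z S -> good Z -> maximal_sep Y Z S -> model W (Z :|: S) B beta ->
    rooted_at S W beta sigma -> concl.
  elim: n => // n IH in W Z S beta sigma *.
  move=> lt Wc dW sZ gZ mZ mod [cS sigP].
  have [WE|nWE] := eqVneq W (desc c).
    exists Z, S; split=> //; first by rewrite cS WE.
    by right; exists beta; rewrite -WE.
  have Wlt : #|W| < #|desc c| by apply: proper_card; rewrite properEneq nWE.
  have [w0 w0c w0W] : exists2 w, w \in desc c & w \notin W.
    by apply/subsetPn; apply: contraNN nWE => s; rewrite eqEsubset Wc.
  have w0P : w0 \in desc c :\: W by rewrite inE w0W.
  (* A missing vertex of least level is either [c] or has its parent in [W]. *)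
  case: (arg_minnP (P := [pred w in desc c :\: W]) lev w0P) => w /= /setDP[wc wW] wmin.
  have pwW : w != c -> p w \in W.
    move=> nwc; have [pw pwc] := desc_parent wc nwc; apply: contraT => npw.
    have := wmin (p w); rewrite inE npw pwc => /(_ isT).
    by rewrite (lev_parent pw) ltnn.
  have step y : y \in Y -> y \notin Z :|: S ->
      (w = c /\ y \in B) \/
      [/\ w != c, p w \in W & exists2 s, s \in beta (p w) & sedge s y] -> concl.
    move=> yY yZS hw.
    have mod' := model_add Wc dW wc wW yZS mod hw.
    rewrite setUCA in mod'.
    have [|Z' [S' [beta' [sigma' [h1 h2 h3 h4 h5]]]]] :=
      relink (sigma := fun x => if x == w then y else sigma x) sZ gZ mZ yY yZS mod'.
      split=> [|x].
        by rewrite !cardsU1 wW cS; move: yZS; rewrite inE negb_or => /andP[_ ->].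
      case/setU1P=> [->|xW]; first by rewrite eqxx set11 setU11.
      have -> : (x == w) = false by apply: contraNF wW => /eqP <-.
      by have [? ?] := sigP x xW; split=> //; rewrite inE; apply/orP; right.
    apply: (IH _ _ _ _ _ _ _ _ h1 h2 h3 h4 h5).
    - rewrite cardsU1 wW; lia.
    - by rewrite subUset sub1set wc.
    - move=> x /setU1P[->|xW] nxc; rewrite inE; first by rewrite pwW ?orbT.
      by rewrite dW ?orbT.
  have [wE|nwc] := eqVneq w c.
    have [s|/subsetPn[y /setIP[yY yB] yZS]] := boolP (Y :&: B \subset Z :|: S).
      by exists Z, S; split=> //; rewrite cS ?(ltnW Wlt) //; left.
    by apply: (step y) => //; left.
  have pW := pwW nwc; have [sb sS] := sigP _ pW; set s := sigma (p w) in sb sS.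
  have [ZY SY dZS sepZ] := sZ.
  have [[y [yY yZS sy]]|nex] :=
    pselect (exists y, [/\ y \in Y, y \notin Z :|: S & sedge s y]).
    by apply: (step y) => //; right; split=> //; exists s.
  have sY := subsetP SY s sS; have sZN : s \notin Z by rewrite (disjointFl dZS sS).
  have nbad : ~ good (s |: Z).
    move=> g; have e : s |: Z = Z.
      apply: (mZ _ (S :\ s)) => //.
      - split.
        + by rewrite subUset sub1set sY.
        + by apply: subset_trans SY; apply: subsetDl.
        + rewrite disjoint_setUl disjoints1 !inE eqxx /=.
          by apply: disjointWr dZS; apply: subsetDl.
        + move=> u v /setU1P[->|uZ] vY uv.
            rewrite setUAC setD1K // setUC; apply: contrapT => /negP h.
            by apply: nex; exists v.
          by have := sepZ u v uZ vY uv; rewrite !inE; case: eqP => //= _; rewrite orbT.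
      - exact: subsetUr.
      - by rewrite setUAC setD1K // setUC.
      - by apply: subset_leq_card; apply: subsetDl.
    by rewrite -e setU11 in sZN.
  have [C [CZ cC nC]] := bad_component nbad.
  have sC : s \in C.
    apply: contraT => nsC; exfalso; apply: nC; apply: good_sub gZ.
    apply/subsetP=> x xC; have := subsetP CZ x xC; case/setU1P=> // e.
    by rewrite -e xC in nsC.
  have CU : C \subset Z :|: S.
    by apply: subset_trans CZ _; rewrite subUset sub1set inE sS orbT subsetUl.
  (* Starting from [B], the modelled branch sets lead to [s] and so to [C]. Stopping at the first
     vertex [a] of [C] gives [D]; the model in [C] is rooted at [a], and [D] brings its root to
     [B]. *)
  have [E [b [cE EU bE bB pE]]] := model_reach Wc dW mod pW.
  have [|D [a [cD DE bD aD DC]]] := connected_approach (C := C) cE bE.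
    by apply/set0Pn; exists s; rewrite inE sC (subsetP pE).
  have /setIP[_ aC] : a \in D :&: C by rewrite DC set11.
  have [beta' mod'] := bad C a cC aC nC.
  exists Z, S; split=> //; first by rewrite cS ltnW.
  right; apply: (model_reroot mod' CU _ cD _ DC); first exact: subset_trans EU.
  by apply/set0Pn; exists b; rewrite inE bD.
(* The embedding starts from a maximal separation above the empty one; its [S] is still empty, as is
   the model. *)
have [|Z [S [[sZ gZ mZ] [_ _ cS]]]] := @extend_to_maximal Y set0 set0 _ good0.
  by split; rewrite ?sub0set // -?setI_eq0 ?setI0 // => x y; rewrite inE.
have S0 : S = set0 by apply/eqP; rewrite -cards_eq0 -leqn0; rewrite cards0 in cS.
(* [sigma] needs a value even for empty [W]; if [G] has no vertices, [Y :&: B] is empty and the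
   first alternative holds. *)
have [y0 _|noy] := pickP (mem [set: G]).
  apply: (grow _ set0 Z S (fun _ => set0) (fun _ => y0) (ltnSn _)) => //.
  - exact: sub0set.
  - by move=> x; rewrite inE.
  - by split=> [w|w w'|w|w]; rewrite inE.
  - by split=> [|w]; rewrite ?S0 ?cards0 // inE.
exists Z, S; split=> //; first by rewrite S0 cards0.
left; split; last by apply/subsetP=> x; have := noy x; rewrite !inE.
by rewrite S0 cards0; apply/card_gt0P; exists c; apply: desc_refl.
Qed.

Hypothesis good_union : forall Z1 Z2,
  (forall x y, x \in Z1 -> y \in Z2 -> ~~ sedge x y) ->
  good Z1 -> good Z2 -> good (Z1 :|: Z2).

Definition desc_of (A : {set V}) : {set V} := \bigcup_(c in A) desc c.

(** Once the subtree below [c] is modelled in [Z :|: S], the others are sought in the rest of [Y].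
    If they fail there, the two separations are united: no edge joins [Z] to [Z'], and the bound on
    [#|S'|] keeps the total strict. *)
Lemma separation_or_forest_model v (A : {set V}) Y B :
  A \subset children v -> (forall c, c \in A -> bad_has_model c) ->
  (exists beta, model (desc_of A) Y B beta) \/
  exists Z S, [/\ sep_in Y Z S, good Z, #|S| < #|desc_of A| & Y :&: B \subset Z :|: S].
Proof.
have [n] := ubnP #|A|; elim: n => // n IH in A Y *; rewrite ltnS => An Av bad.
have [A0|/set0Pn[c cA]] := eqVneq A set0.
  left; exists (fun _ => set0); rewrite A0 /desc_of big_set0.
  by split=> [w|w w'|w|w]; rewrite inE.
have cv := subsetP Av c cA.
pose A' := A :\ c.
have A'A : A' \subset A := subsetDl _ _.
have AE : desc_of A = desc c :|: desc_of A' by rewrite /desc_of (big_setD1 c).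
have dD : [disjoint desc c & desc_of A'].
  rewrite -setI_eq0; apply/eqP/setP=> w; rewrite !in_set0; apply/negP=> /setIP[wc].
  case/bigcupP=> c' c'A wc'; have c'v := subsetP Av _ (subsetP A'A _ c'A).
  by move: c'A; rewrite (desc_children_disjoint c'v cv wc' wc) !inE eqxx.
have cAE : #|desc_of A| = #|desc c| + #|desc_of A'|.
  by rewrite AE cardsU disjoint_setI0 // cards0 subn0.
(* The parent of [c'] is [v], which lies in none of the subtrees below its children. *)
have topc c' : c' \in A -> top (desc_of A) c'.
  move=> c'A; rewrite /top; apply/orP; right; apply/bigcupP=> -[c2 c2A].
  have [pc' _] := childrenP (subsetP Av _ c'A).
  by rewrite pc' => /(desc_child_neq (subsetP Av _ c2A)); rewrite eqxx.
have topD (A2 : {set V}) w : A2 \subset A -> w \in desc_of A2 -> top (desc_of A2) w ->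
    top (desc_of A) w.
  move=> A2A /bigcupP[c2 c2A wc2] tw; have [->|nw] := eqVneq w c2.
    by apply: topc; apply: (subsetP A2A).
  have [pw pc] := desc_parent wc2 nw; move: tw; rewrite {1}/top (negPf pw) /=.
  by case/bigcupP; exists c2.
have d1 : desc c = desc_of [set c] by rewrite /desc_of big_set1.
have [Z [S [sZ gZ cS alt]]] := separation_or_model Y B (bad c cA).
case: alt => [[lt YB]|[beta mod]].
  by right; exists Z, S; split=> //; rewrite cAE (leq_trans lt) ?leq_addr.
have [ZY SY dZS sepZ] := sZ.
have [|||[beta' mod']|[Z' [S' [[ZY' SY' dZS' sepZ'] gZ' cS' YB']]]] := IH A' (Y :\: (Z :|: S)).
- by apply: leq_trans An; rewrite (cardsD1 c A) cA.
- exact: subset_trans Av.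
- by move=> c' c'A; apply: bad; apply: (subsetP A'A).
- left; rewrite AE; have [|w wc||gamma gm] := model_union _ dD _ _ mod mod'.
  + by rewrite disjoint_sym disjoints_subset setDE subsetIr.
  + rewrite -AE; move: wc; rewrite d1; apply: topD; by rewrite sub1set.
  + by rewrite -AE => w; apply: topD.
  + by exists gamma; apply: model_sub gm; rewrite !subUset ZY SY subsetDl.
- right; exists (Z :|: Z'), (S :|: S').
  have nY' x : x \in Y :\: (Z :|: S) -> [/\ x \in Y, x \notin Z & x \notin S].
    by rewrite !inE negb_or -andbA => /and3P[].
  have zY' x : x \in Z' -> [/\ x \in Y, x \notin Z & x \notin S].
    by move/(subsetP ZY')/nY'.
  have sY' x : x \in S' -> [/\ x \in Y, x \notin Z & x \notin S].
    by move/(subsetP SY')/nY'.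
  split.
  + split.
    * by rewrite subUset ZY; apply/subsetP=> x /zY'[].
    * by rewrite subUset SY; apply/subsetP=> x /sY'[].
    * rewrite -setI_eq0; apply/eqP/setP=> x; rewrite in_set0; apply/negP.
      case/setIP=> /setUP[h|h] /setUP[] h'.
      - by rewrite (disjointFr dZS h) in h'.
      - by have [_] := sY' x h'; rewrite h.
      - by have [_ _] := zY' x h; rewrite h'.
      - by rewrite (disjointFr dZS' h) in h'.
    * move=> x y /setUP[h|h] yY xy.
        by have := sepZ x y h yY xy; rewrite !inE => /orP[] ->; rewrite ?orbT.
      case: (boolP (y \in Z :|: S)) => yZS.
        by move: yZS; rewrite !inE => /orP[] ->; rewrite ?orbT.
      have := sepZ' x y h _ xy; rewrite in_setD yZS yY => /(_ isT).
      by rewrite !inE => /orP[] ->; rewrite ?orbT.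
  + apply: good_union => // x y xZ yZ'; apply/negP=> xy.
    have [yY yZ yS] := zY' y yZ'; have := sepZ x y xZ yY xy.
    by rewrite inE (negPf yZ) (negPf yS).
  + apply: leq_ltn_trans (leq_card_setU _ _) _; rewrite cAE; lia.
  + apply/subsetP=> x /setIP[xY xB].
    case: (boolP (x \in Z :|: S)) => yZS.
      by move: yZS; rewrite !inE => /orP[] ->; rewrite ?orbT.
    have /(subsetP YB') : x \in (Y :\: (Z :|: S)) :&: B by rewrite in_setI in_setD yZS xY.
    by rewrite !inE => /orP[] ->; rewrite ?orbT.
Qed.

End Models.
End Descendants.

(** * Partitions with a path decomposition of the quotient *)

(* [lia] would case-split on every boolean hypothesis. *)
Ltac arith_lia :=
  repeat match goal with
  | H : is_true ?b |- _ =>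
    lazymatch b with
    | leq _ _ => fail
    | andb _ _ => fail
    | _ => clear H
    end
  end; lia.

Section Layouts.
Variables (G : sgraph) (m : nat).
Implicit Types (C P S U Y Z : {set G}) (col l r : G -> nat).

(* The colour classes are the parts of a partition of [U]; the part of [x] lies
   in the bags numbered [l x, ..., r x]. *)
Definition layout k U col l r : Prop :=
  [/\ {in U, forall x, l x <= r x},
      {in U &, forall x y, col x = col y -> l x = l y /\ r x = r y},
      {in U &, forall x y, sedge x y -> l x <= r y},
      forall i, exists2 cs : seq nat, size cs <= k &
        {in U, forall x, l x <= i <= r x -> col x \in cs}
    & forall c, #|[set x in U | col x == c]| <= m].

Definition decomposable k U : Prop := exists col l r, layout k U col l r.

Lemma decomposable_sub k U U' : U' \subset U -> decomposable k U -> decomposable k U'.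
Proof.
move=> /subsetP s [col [l [r [h1 h2 h3 h4 h5]]]]; exists col, l, r; split.
- by move=> x /s; apply: h1.
- by move=> x y /s xU /s; apply: h2.
- by move=> x y /s xU /s; apply: h3.
- by move=> i; have [cs ? h] := h4 i; exists cs => // x /s; apply: h.
- move=> c; apply: leq_trans (h5 c); apply: subset_leq_card; apply/subsetP=> x.
  by rewrite !inE => /andP[/s ->].
Qed.

Lemma decomposable0 k : decomposable k set0.
Proof.
exists (fun _ => 0), (fun _ => 0), (fun _ => 0); split=> [x|x y|x y|i|c].
- by rewrite inE.
- by rewrite inE.
- by rewrite inE.
- by exists [::] => // x; rewrite inE.
- rewrite (_ : [set x in set0 | _] = set0) ?cards0 //.
  by apply/setP=> x; rewrite !inE.
Qed.

(** The second layout is shifted past the last bag of the first, and even and odd colours keep the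
    parts apart. *)
Lemma decomposable_union k Z1 Z2 :
  (forall x y, x \in Z1 -> y \in Z2 -> ~~ sedge x y) ->
  decomposable k Z1 -> decomposable k Z2 -> decomposable k (Z1 :|: Z2).
Proof.
move=> nE [c1 [l1 [r1 [a1 a2 a3 a4 a5]]]] [c2 [l2 [r2 [b1 b2 b3 b4 b5]]]].
pose M := (\max_(x in Z1) r1 x).+1.
have rM x : x \in Z1 -> r1 x < M by move=> xZ; rewrite ltnS leq_bigmax_cond.
pose col x := if x \in Z1 then (c1 x).*2 else (c2 x).*2.+1.
exists col, (fun x => if x \in Z1 then l1 x else l2 x + M),
  (fun x => if x \in Z1 then r1 x else r2 x + M).
have Z2P x : x \in Z1 :|: Z2 -> x \notin Z1 -> x \in Z2 by rewrite inE => /orP[->|].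
split=> [x xZ|x y xZ yZ|x y xZ yZ|i|c].
- by case: ifPn => x1; [apply: a1 | rewrite leq_add2r b1 ?Z2P].
- rewrite /col; case: ifPn => x1; case: ifPn => y1 e; try lia.
    by apply: a2 => //; lia.
  have [|||-> ->//] := b2 x y; [exact: Z2P|exact: Z2P|lia].
- case: ifPn => x1; case: ifPn => y1 xy.
  + exact: a3.
  + by have := nE x y x1 (Z2P y yZ y1); rewrite xy.
  + by have := nE y x y1 (Z2P x xZ x1); rewrite sedge_sym xy.
  + by rewrite leq_add2r b3 ?Z2P.
- case: (ltnP i M) => iM.
    have [cs s1 h] := a4 i; exists [seq c.*2 | c <- cs]; first by rewrite size_map.
    move=> x xZ; rewrite /col; case: ifPn => x1; last by lia.
    by move=> /h hx; apply: map_f; apply: hx.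
  have [cs s1 h] := b4 (i - M); exists [seq c.*2.+1 | c <- cs]; first by rewrite size_map.
  move=> x xZ; rewrite /col; case: ifPn => x1; first by have := rM x x1; lia.
  by move=> li; apply: (map_f (fun c => c.*2.+1)); apply: h; [apply: Z2P|lia].
- case: (boolP (odd c)) => oc.
    apply: leq_trans (b5 c./2); apply: subset_leq_card; apply/subsetP=> x; rewrite !inE /col.
    case: ifPn => x1 /=; first by move/eqP; lia.
    by move=> /andP[-> /eqP e] /=; apply/eqP; lia.
  apply: leq_trans (a5 c./2); apply: subset_leq_card; apply/subsetP=> x; rewrite !inE /col.
  case: ifPn => x1 /=; first by move=> /eqP; lia.
  by move=> /andP[_ /eqP]; lia.
Qed.

(** If a component and the rest were both decomposable, so would be their union, as no edge joins
    them. Thus either the component is as wanted or induction applies to the rest. *)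
Lemma undecomposable_component k Z : ~ decomposable k Z ->
  exists C, [/\ C \subset Z, connected_set C & ~ decomposable k C].
Proof.
have [n] := ubnP #|Z|; elim: n => // n IH in Z *; rewrite ltnS => Zn nZ.
have [Z0|/set0Pn[x xZ]] := eqVneq Z set0.
  by case: nZ; rewrite Z0; apply: decomposable0.
pose C := component Z x.
have CZ : C \subset Z := component_sub xZ.
have [dC|nC] := pselect (decomposable k C); last first.
  by exists C; split=> //; apply: component_connected.
have [dD|nD] := pselect (decomposable k (Z :\: C)).
  case: nZ; rewrite -(setID Z C) (setIidPr CZ); apply: decomposable_union => //.
  move=> u v uC /setDP[vZ vC]; apply: contraNN vC => uv.
  exact: component_closed uC vZ uv.
have [|D [DZ cD nD']] := IH (Z :\: C) _ nD.
  apply: leq_trans Zn; apply: proper_card; rewrite properEneq subsetDl andbT.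
  by apply/eqP=> e; have := xZ; rewrite -e inE mem_component.
by exists D; split=> //; apply: subset_trans DZ (subsetDl _ _).
Qed.

(** [S] is one whole part that reaches the last bag [N], so it can be prolonged into bags appended
    later. *)
Definition ending_layout k U S : Prop :=
  exists N cS col l r, [/\ layout k U col l r, {in U, forall x, r x <= N},
    {in U, forall x, (col x == cS) = (x \in S)} & {in S, forall x, r x = N}].

Lemma ending_layout_decomposable k U S : ending_layout k U S -> decomposable k U.
Proof. by case=> N [cS [col [l [r [h _ _ _]]]]]; exists col, l, r. Qed.

Lemma ending_layout1 k a : 0 < m -> ending_layout k.+1 [set a] [set a].
Proof.
move=> m0; exists 0, 0, (fun _ => 0), (fun _ => 0), (fun _ => 0).
split=> //; split=> // [i|c]; first by exists [:: 0].
apply: leq_trans m0; rewrite -(cards1 a); apply: subset_leq_card.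
by apply/subsetP=> x; rewrite !inE => /andP[].
Qed.

(** The bags of [Z] are appended after [N], with [S] and [S'] added to each. Every edge from [U] to
    a new vertex starts in [S], which is present throughout. *)
Lemma ending_layout_extend k U S Z S' :
  S \subset U -> [disjoint U & Z] -> [disjoint U & S'] -> [disjoint Z & S'] ->
  (forall x y, x \in U -> x \notin S -> y \in Z :|: S' -> ~~ sedge x y) ->
  #|S'| <= m -> decomposable k Z -> ending_layout k.+2 U S ->
  ending_layout k.+2 (U :|: Z :|: S') S'.
Proof.
move=> SU dUZ dUS dZS nE cS' [cz [lz [rz [z1 z2 z3 z4 z5]]]]
  [N [cS [cu [lu [ru [[u1 u2 u3 u4 u5] rN colS rS]]]]]].
pose M := \max_(x in Z) rz x.
have rM x : x \in Z -> rz x <= M by move=> xZ; rewrite leq_bigmax_cond.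
have lM x : x \in Z -> lz x <= M by move=> xZ; apply: leq_trans (rM x xZ); apply: z1.
(* Colour [0] is reserved for [S']; odd colours serve [U] and positive even ones [Z]. *)
pose col x := if x \in U then (cu x).*2.+1 else if x \in Z then (cz x).*2.+2 else 0.
pose l x := if x \in U then lu x else if x \in Z then lz x + N.+1 else N.+1.
pose r x := if x \in S then N.+1 + M else if x \in U then ru x
            else if x \in Z then rz x + N.+1 else N.+1 + M.
have inS x : x \in S -> [/\ x \in U, (x \in Z) = false & (x \in S') = false].
  by move=> /(subsetP SU) xU; rewrite xU (disjointFr dUZ xU) (disjointFr dUS xU).
have inU x : x \in U -> (x \in Z) = false /\ (x \in S') = false.
  by move=> xU; rewrite (disjointFr dUZ xU) (disjointFr dUS xU).
have cases x : x \in U :|: Z :|: S' ->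
    [\/ x \in S, [/\ x \in U & x \notin S], [/\ x \in Z, x \notin U & x \notin S]
      | [/\ x \in S', x \notin U, x \notin Z & x \notin S]].
  move=> xx; case: (boolP (x \in S)) => [xS|xS]; first by constructor 1.
  case: (boolP (x \in U)) => [xU|xU]; first by constructor 2.
  case: (boolP (x \in Z)) => [xZ|xZ]; first by constructor 3.
  by constructor 4; split=> //; move: xx; rewrite !inE (negPf xU) (negPf xZ).
have fS x : x \in S -> [/\ col x = (cu x).*2.+1, l x = lu x, r x = N.+1 + M, cu x = cS & ru x = N].
  move=> xS; have [xU _ _] := inS x xS; rewrite /col /l /r xS xU rS //.
  by split=> //; apply/eqP; rewrite colS.
have fU x : x \in U -> x \notin S ->
    [/\ col x = (cu x).*2.+1, l x = lu x, r x = ru x, cu x <> cS & ru x <= N].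
  move=> xU xS; rewrite /col /l /r xU (negPf xS); split=> //; last exact: rN.
  by apply/eqP; rewrite colS.
have fZ x : x \in Z -> x \notin U -> x \notin S ->
    [/\ col x = (cz x).*2.+2, l x = lz x + N.+1, r x = rz x + N.+1 & rz x <= M].
  by move=> xZ xU xS; rewrite /col /l /r xZ (negPf xU) (negPf xS) rM.
have fS' x : x \notin U -> x \notin Z -> x \notin S ->
    [/\ col x = 0, l x = N.+1 & r x = N.+1 + M].
  by move=> xU xZ xS; rewrite /col /l /r (negPf xZ) (negPf xU) (negPf xS).
have SUx x : x \in S -> x \in U by move/(subsetP SU).
exists (N.+1 + M), 0, col, l, r; split; first split.
- move=> x /cases[xS|[xU xS]|[xZ xU xS]|[xS' xU xZ xS]].
  + by have [_ -> -> _ e] := fS x xS; have := u1 x (SUx x xS); arith_lia.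
  + by have [_ -> -> _ _] := fU x xU xS; apply: u1.
  + by have [_ -> -> _] := fZ x xZ xU xS; have := z1 x xZ; arith_lia.
  + by have [_ -> ->] := fS' x xU xZ xS; arith_lia.
- move=> x y /cases[xS|[xU xS]|[xZ xU xS]|[xS' xU xZ xS]]
      /cases[yS|[yU yS]|[yZ yU yS]|[yS' yU yZ yS]].
  + have [-> -> -> e1 _] := fS x xS; have [-> -> -> e2 _] := fS y yS => _; split=> //.
    by have [] := u2 x y (SUx x xS) (SUx y yS); rewrite ?e1 ?e2.
  + by have [-> -> -> e1 _] := fS x xS; have [-> -> -> e2 _] := fU y yU yS; arith_lia.
  + by have [-> -> -> e1 _] := fS x xS; have [-> -> -> e2] := fZ y yZ yU yS; arith_lia.
  + by have [-> -> -> e1 _] := fS x xS; have [-> -> ->] := fS' y yU yZ yS; arith_lia.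
  + by have [-> -> -> e1 _] := fU x xU xS; have [-> -> -> e2 _] := fS y yS; arith_lia.
  + have [-> -> -> e1 _] := fU x xU xS; have [-> -> -> e2 _] := fU y yU yS => e.
    by apply: u2 => //; arith_lia.
  + by have [-> -> -> e1 _] := fU x xU xS; have [-> -> -> e2] := fZ y yZ yU yS; arith_lia.
  + by have [-> -> -> e1 _] := fU x xU xS; have [-> -> ->] := fS' y yU yZ yS; arith_lia.
  + by have [-> -> -> e1] := fZ x xZ xU xS; have [-> -> -> e2 _] := fS y yS; arith_lia.
  + by have [-> -> -> e1] := fZ x xZ xU xS; have [-> -> -> e2 _] := fU y yU yS; arith_lia.
  + have [-> -> -> e1] := fZ x xZ xU xS; have [-> -> -> e2] := fZ y yZ yU yS => e.
    by have [|-> ->//] := z2 x y xZ yZ; arith_lia.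
  + by have [-> -> -> e1] := fZ x xZ xU xS; have [-> -> ->] := fS' y yU yZ yS; arith_lia.
  + by have [-> -> ->] := fS' x xU xZ xS; have [-> -> -> e2 _] := fS y yS; arith_lia.
  + by have [-> -> ->] := fS' x xU xZ xS; have [-> -> -> e2 _] := fU y yU yS; arith_lia.
  + by have [-> -> ->] := fS' x xU xZ xS; have [-> -> -> e2] := fZ y yZ yU yS; arith_lia.
  + by have [-> -> ->] := fS' x xU xZ xS; have [-> -> ->] := fS' y yU yZ yS.
- move=> x y /cases[xS|[xU xS]|[xZ xU xS]|[xS' xU xZ xS]]
      /cases[yS|[yU yS]|[yZ yU yS]|[yS' yU yZ yS]] xy.
  + have [_ -> _ _ _] := fS x xS; have [_ _ -> _ e] := fS y yS.
    by have := u3 x y (SUx x xS) (SUx y yS) xy; arith_lia.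
  + have [_ -> _ _ _] := fS x xS; have [_ _ -> _ e] := fU y yU yS.
    by have := u3 x y (SUx x xS) yU xy; arith_lia.
  + have [_ -> _ _ e'] := fS x xS; have [_ _ -> e] := fZ y yZ yU yS.
    by have := u1 x (SUx x xS); arith_lia.
  + have [_ -> _ _ e'] := fS x xS; have [_ _ ->] := fS' y yU yZ yS.
    by have := u1 x (SUx x xS); arith_lia.
  + have [_ -> _ _ _] := fU x xU xS; have [_ _ -> _ e] := fS y yS.
    by have := u3 x y xU (SUx y yS) xy; arith_lia.
  + have [_ -> _ _ _] := fU x xU xS; have [_ _ -> _ e] := fU y yU yS.
    exact: u3.
  + by have := nE x y xU xS; rewrite inE yZ xy => /(_ isT).
  + by have := nE x y xU xS; rewrite inE yS' orbT xy => /(_ isT).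
  + have [_ -> _ e] := fZ x xZ xU xS; have [_ _ -> _ _] := fS y yS.
    by have := lM x xZ; arith_lia.
  + by have := nE y x yU yS; rewrite inE xZ sedge_sym xy => /(_ isT).
  + have [_ -> _ _] := fZ x xZ xU xS; have [_ _ -> _] := fZ y yZ yU yS.
    by rewrite leq_add2r; apply: z3.
  + have [_ -> _ e] := fZ x xZ xU xS; have [_ _ ->] := fS' y yU yZ yS.
    by have := lM x xZ; arith_lia.
  + have [_ -> _] := fS' x xU xZ xS; have [_ _ -> _ e] := fS y yS; arith_lia.
  + by have := nE y x yU yS; rewrite inE xS' orbT sedge_sym xy => /(_ isT).
  + have [_ -> _] := fS' x xU xZ xS; have [_ _ -> e] := fZ y yZ yU yS; arith_lia.
  + have [_ -> _] := fS' x xU xZ xS; have [_ _ ->] := fS' y yU yZ yS; arith_lia.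
- move=> i; case: (leqP i N) => iN.
    have [cs scs h] := u4 i; exists [seq c.*2.+1 | c <- cs]; first by rewrite size_map.
    move=> x /cases[xS|[xU xS]|[xZ xU xS]|[xS' xU xZ xS]].
    + have [-> -> _ _ e] := fS x xS => li; apply: (map_f (fun c => c.*2.+1)).
      by apply: h; [apply: SUx|arith_lia].
    + have [-> -> -> _ e] := fU x xU xS => li; apply: (map_f (fun c => c.*2.+1)).
      exact: h.
    + by have [_ -> _ e] := fZ x xZ xU xS; arith_lia.
    + by have [_ -> _] := fS' x xU xZ xS; arith_lia.
  (* The shift of [Z] by [N.+1] is undone; [0] and [cS.*2.+1] are the colours of [S'] and [S]. *)
  have [cs scs h] := z4 (i - N.+1).
  exists [:: 0, cS.*2.+1 & [seq c.*2.+2 | c <- cs]]; first by rewrite /= size_map.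
  move=> x /cases[xS|[xU xS]|[xZ xU xS]|[xS' xU xZ xS]].
  + by have [-> -> _ -> e] := fS x xS => _; rewrite !inE eqxx orbT.
  + by have [_ _ -> _ e] := fU x xU xS; arith_lia.
  + have [-> -> -> e] := fZ x xZ xU xS => li; rewrite !inE; apply/orP; right.
    by apply/orP; right; apply: (map_f (fun c => c.*2.+2)); apply: h => //; arith_lia.
  + by have [-> _ _] := fS' x xU xZ xS; rewrite inE.
- move=> c; have [c0|c0] := eqVneq c 0.
    apply: leq_trans cS'; apply: subset_leq_card; apply/subsetP=> x; rewrite c0 inE.
    case/andP=> /cases[xS|[xU xS]|[xZ xU xS]|[xS' xU xZ xS] //].
    + by have [-> _ _ _ _] := fS x xS.
    + by have [-> _ _ _ _] := fU x xU xS.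
    + by have [-> _ _ _] := fZ x xZ xU xS.
  case: (boolP (odd c)) => oc.
    apply: leq_trans (u5 c./2); apply: subset_leq_card; apply/subsetP=> x; rewrite !inE.
    rewrite -!in_setU => /andP[/cases[xS|[xU xS]|[xZ xU xS]|[xS' xU xZ xS]]].
    + have [-> _ _ _ _] := fS x xS; rewrite SUx // => /eqP e /=; apply/eqP; clear -c0 oc e; lia.
    + have [-> _ _ _ _] := fU x xU xS; rewrite xU // => /eqP e /=; apply/eqP; clear -c0 oc e; lia.
    + have [-> _ _ _] := fZ x xZ xU xS; move/eqP; clear -c0 oc; lia.
    + have [-> _ _] := fS' x xU xZ xS; move/eqP; clear -c0 oc; lia.
  apply: leq_trans (z5 c./2.-1); apply: subset_leq_card; apply/subsetP=> x; rewrite !inE.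
  rewrite -!in_setU => /andP[/cases[xS|[xU xS]|[xZ xU xS]|[xS' xU xZ xS]]].
  + have [-> _ _ _ _] := fS x xS; move/eqP; clear -c0 oc; lia.
  + have [-> _ _ _ _] := fU x xU xS; move/eqP; clear -c0 oc; lia.
  + have [-> _ _ _] := fZ x xZ xU xS; rewrite xZ // => /eqP e /=; apply/eqP; clear -c0 oc e; lia.
  + have [-> _ _] := fS' x xU xZ xS; move/eqP; clear -c0 oc; lia.
- move=> x /cases[xS|[xU xS]|[xZ xU xS]|[xS' xU xZ xS]].
  + by have [_ _ -> _ _] := fS x xS.
  + by have [_ _ -> _ e] := fU x xU xS; arith_lia.
  + by have [_ _ -> e] := fZ x xZ xU xS; arith_lia.
  + by have [_ _ ->] := fS' x xU xZ xS.
- move=> x /cases[xS|[xU xS]|[xZ xU xS]|[xS' xU xZ xS]].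
  + by have [-> _ _ _ _] := fS x xS; have [_ _ ->] := inS x xS.
  + by have [-> _ _ _ _] := fU x xU xS; have [_ ->] := inU x xU.
  + by have [-> _ _ _] := fZ x xZ xU xS; rewrite (disjointFr dZS xZ).
  + by have [-> _ _] := fS' x xU xZ xS; rewrite xS' eqxx.
- move=> x xS'; have xU : x \notin U by rewrite (disjointFl dUS xS').
  have xZ : x \notin Z by rewrite (disjointFl dZS xS').
  have xS : x \notin S by apply: contraNN xU; apply: SUx.
  by have [_ _ ->] := fS' x xU xZ xS.
Qed.

End Layouts.

(** * Sweeping a connected set *)

Section Sweep.
Variables (V : finType) (p : V -> V) (lev : V -> nat).
Hypothesis lev_parent : forall v, p v != v -> lev v = (lev (p v)).+1.
Variables (G : sgraph) (m : nat).
Hypothesis m_gt0 : 0 < m.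
Implicit Types (B C P S Y Z : {set G}).

Lemma desc_of_children v : desc_of p (children p v) = desc p v :\ v.
Proof.
apply/setP=> w; apply/bigcupP/setD1P => [[c cv wc]|[nw wv]].
  split; first exact: desc_child_neq lev_parent _ _ _ cv wc.
  exact: desc_child_sub cv wc.
exact: (desc_childE lev_parent).
Qed.

(** The topmost vertices below [v] are its children; rooting them at neighbours of [P] supplies
    their edges to the branch set of [v]. *)
Lemma model_add_root v C P a beta :
  connected_set P -> P \subset C -> a \in P ->
  model p (desc_of p (children p v)) (C :\: P) [set y | [exists x in P, sedge x y]] beta ->
  model p (desc p v) C [set a] (fun w => if w == v then P else beta w).
Proof.
move=> cP PC aP; rewrite desc_of_children => -[m1 m2 m3 m4].
have topv : top p (desc p v) v.
  rewrite /top; have [//|pv /=] := eqVneq (p v) v; exact: (parent_notin_desc lev_parent).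
have inD w : w \in desc p v -> w != v -> w \in desc p v :\ v by move=> h n; apply/setD1P.
have Pd w : w \in desc p v -> w != v -> [disjoint P & beta w].
  move=> wv nw; have [_ s] := m1 w (inD w wv nw); rewrite disjoint_sym disjoints_subset.
  by apply: subset_trans s _; rewrite setDE subsetIr.
split=> [w wv|w w' wv w'v n|w wv tw|w wv nt].
- have [_//|nw] := eqVneq w v; have [? s] := m1 w (inD w wv nw); split=> //.
  exact: subset_trans s (subsetDl _ _).
- have [we|nw] := eqVneq w v; have [we'|nw'] := eqVneq w' v.
  + by rewrite we we' eqxx in n.
  + exact: Pd.
  + by rewrite disjoint_sym; apply: Pd.
  + by apply: m2 => //; apply: inD.
- have [we|nw] := eqVneq w v; first by apply/set0Pn; exists a; rewrite !inE aP eqxx.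
  by have [pw pc] := desc_parent wv nw; move: tw; rewrite /top (negPf pw) pc.
- have nw : w != v by apply: contraNneq nt => ->.
  have [pw pv] := desc_parent wv nw; rewrite (negPf nw).
  have [pe|npe] := eqVneq (p w) v.
    have [|y /setIP[yb]] := set0Pn _ (m3 w (inD w wv nw) _).
      by rewrite /top pe !inE eqxx orbT.
    by rewrite inE => /existsP[x /andP[xP xy]]; exists y, x; rewrite sedge_sym.
  by apply: m4; [apply: inD | rewrite /top (negPf pw) (inD _ pv npe)].
Qed.

(* [P] is the part swept so far and [S] its frontier.  A model below the children
   of [v] rooted in the neighbourhood of [P] would extend to [v] by taking [P] as
   its branch set, so the next frontier is given by [separation_or_forest_model]. *)
Lemma sweep h v C a :
  (forall c, c \in children p v -> bad_has_model p (@decomposable G m h) c) ->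
  #|desc p v| <= m.+2 -> connected_set C -> a \in C ->
  ~ (exists beta, model p (desc p v) C [set a] beta) -> decomposable m h.+2 C.
Proof.
move=> bad cardv cC aC nomodel.
have main n P S : #|C| - #|P| < n -> connected_set P -> a \in P -> S \subset P ->
    P \subset C -> (forall x y, x \in P -> x \notin S -> y \in C :\: P -> ~~ sedge x y) ->
    ending_layout m h.+2 P S -> decomposable m h.+2 C.
  elim: n => // n IH in P S * => lt cP aP SP PC nE lay.
  pose B := [set y | [exists x in P, sedge x y]].
  (* Without a neighbour in the rest of [C], [P] is closed in the connected set [C], hence all of
     it. *)
  have [B0|/set0Pn[y0 /setIP[y0Y y0B]]] := eqVneq ((C :\: P) :&: B) set0.
    suff -> : C = P by apply: ending_layout_decomposable lay.
    apply/eqP; rewrite eqEsubset PC andbT.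
    apply: (connected_set_sub cC aC aP) => x y xP yC xy; apply: contraT => yP.
    have : y \in (C :\: P) :&: B.
      by rewrite !inE yP yC; apply/existsP; exists x; rewrite xP.
    by rewrite B0 inE.
  have [|[Z [S' [[ZY SY dZS sepZ] dZ cS' YB]]]] :
      (exists beta, model p (desc_of p (children p v)) (C :\: P) B beta) \/
      exists Z S', [/\ sep_in (C :\: P) Z S', decomposable m h Z,
        #|S'| < #|desc_of p (children p v)| & (C :\: P) :&: B \subset Z :|: S'].
  - apply: (separation_or_forest_model lev_parent) => //.
    + by move=> Z Z'; apply: decomposable_sub.
    + exact: decomposable0.
    + exact: undecomposable_component.
    + exact: decomposable_union.
  - by case=> beta /(model_add_root cP PC aP) mod; case: nomodel; eexists; apply: mod.
  (* Leaving out the root [v] saves one vertex, and the strict bound on [#|S'|] saves the second. *)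
  have cS'm : #|S'| <= m.
    move: cS'; rewrite desc_of_children; have := cardsD1 v (desc p v).
    by rewrite desc_refl; arith_lia.
  pose D := P :|: Z :|: S'; pose Q := component D a.
  have aD : a \in D by rewrite !inE aP.
  have QD : Q \subset D := component_sub aD.
  have PQ : P \subset Q.
    apply: (connected_set_sub cP aP (mem_component _ _)) => x y xQ yP xy.
    by apply: (component_closed aD xQ) => //; rewrite !inE yP.
  have nP x : x \in C :\: P -> x \in C /\ x \notin P by rewrite inE => /andP[].
  have ZP x : x \in Z -> x \in C /\ x \notin P by move/(subsetP ZY)/nP.
  have S'P x : x \in S' -> x \in C /\ x \notin P by move/(subsetP SY)/nP.
  have QE : P :|: (Z :&: Q) :|: (S' :&: Q) = Q.
    apply/setP=> x; rewrite !in_setU !in_setI; case: (boolP (x \in Q)) => xQ.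
      by have := subsetP QD x xQ; rewrite !in_setU !andbT.
    by rewrite !andbF !orbF; apply: contraNF xQ; apply: (subsetP PQ).
  have QC : Q \subset C.
    apply: subset_trans QD _; rewrite !subUset PC /=.
    by rewrite (subset_trans ZY (subsetDl _ _)) (subset_trans SY (subsetDl _ _)).
  have Bsub y x : x \in P -> y \in C -> y \notin P -> sedge x y -> y \in Z :|: S'.
    move=> xP yC yP xy; apply: (subsetP YB); rewrite !inE yC yP /=.
    by apply/existsP; exists x; rewrite xP.
  apply: (IH Q (S' :&: Q)) => //.
  - have [y0C y0P] := nP y0 y0Y; move: (y0B); rewrite inE => /existsP[x /andP[xP xy]].
    have y0Q : y0 \in Q.
      apply: (component_closed aD (subsetP PQ x xP) _ xy).
      by rewrite /D -setUA inE (Bsub _ x) ?orbT.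
    have := subset_leq_card QC; have : #|P| < #|Q|; last by arith_lia.
    by apply: proper_card; apply/properP; split=> //; exists y0.
  - exact: component_connected.
  - exact: mem_component.
  - exact: subsetIr.
  - move=> x y xQ xS /setDP[yC yQ]; apply/negP=> xy.
    have yP : y \notin P by apply: contraNN yQ; apply: (subsetP PQ).
    have yZS : y \in Z :|: S'.
      move: (xQ); rewrite -{1}QE => /setUP[/setUP[xP|/setIP[xZ _]]|xS'].
      - exact: Bsub xy.
      - by apply: sepZ xy => //; rewrite inE yP.
      - by rewrite xS' in xS.
    by case/negP: yQ; apply: (component_closed aD xQ) => //; rewrite /D -setUA inE yZS orbT.
  - rewrite -[X in ending_layout _ _ X _]QE; apply: (ending_layout_extend SP) => //.
    + rewrite disjoint_sym disjoints_subset; apply/subsetP=> x /setIP[/ZP[_ xP] _].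
      by rewrite inE.
    + rewrite disjoint_sym disjoints_subset; apply/subsetP=> x /setIP[/S'P[_ xP] _].
      by rewrite inE.
    + by apply: disjointW dZS; apply: subsetIl.
    + move=> x y xP xS; rewrite -setIUl => /setIP[yZS _]; apply: nE => //.
      by case/setUP: yZS => [/ZP[? ?]|/S'P[? ?]]; rewrite inE; apply/andP.
    + by apply: leq_trans cS'm; apply: subset_leq_card; apply: subsetIl.
    + by apply: decomposable_sub dZ; apply: subsetIl.
apply: (main _ [set a] [set a] (ltnSn _)); rewrite ?set11 ?sub1set //.
- exact: connected_set1.
- exact: set11.
- by move=> x y /set1P ->; rewrite set11.
- exact: ending_layout1.
Qed.

Lemma undecomposable_has_model h v :
  (forall w, w \in desc p v -> lev w <= lev v + h) -> #|desc p v| <= m.+2 ->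
  bad_has_model p (@decomposable G m (2 * h)) v.
Proof.
elim: h v => [|h IH] v ht cv C a cC aC nC.
  (* At height 0 the subtree is [v] alone. *)
  exists (fun _ => [set a]).
  have dv w : w \in desc p v -> w = v.
    move=> wv; apply/eqP; apply: contraT => nw.
    have [c cv' wc] := desc_childE lev_parent wv nw.
    have [pc npc] := childrenP cv'; have := desc_lev lev_parent wc.
    by have := ht w wv; rewrite (lev_parent npc) pc; arith_lia.
  split=> [w wv|w w' /dv -> /dv ->|w _ _|w wv].
  - by split; [apply: connected_set1 | rewrite sub1set].
  - by rewrite eqxx.
  - by rewrite setIid; apply/set0Pn; exists a; rewrite set11.
  - rewrite /top negb_or negbK (dv w wv) => /andP[pv].
    by rewrite (negPf (parent_notin_desc lev_parent pv)).
apply: contrapT => nomodel; apply: nC.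
(* Each level of the tree costs two more parts per bag. *)
rewrite mulnS; apply: (sweep _ cv cC aC nomodel) => c cv'.
have [pc npc] := childrenP cv'.
apply: IH => [w wc|].
  by have := ht w (desc_child_sub cv' wc); rewrite (lev_parent npc) pc; arith_lia.
apply: leq_trans cv; apply: subset_leq_card; apply/subsetP=> w; exact: desc_child_sub.
Qed.

End Sweep.

(** * From layouts to strong products *)

Lemma contained_inj (G J : sgraph) (f : G -> J) :
  injective f -> (forall x y, sedge x y -> sedge (f x) (f y)) -> contained G J.
Proof.
move=> finj fE.
(* Only images of edges of [G] are kept, since [f] need not reflect adjacency. *)
pose E : rel J := fun u v => [exists x, exists y, [&& u == f x, v == f y & sedge x y]].
have EP u v : reflect (exists x y, [/\ u = f x, v = f y & sedge x y]) (E u v).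
  apply: (iffP existsP) => [[x /existsP[y /and3P[/eqP-> /eqP-> xy]]]|[x [y [-> -> xy]]]].
    by exists x, y.
  by exists x; apply/existsP; exists y; rewrite !eqxx.
have Esym : symmetric E.
  by move=> u v; apply/EP/EP=> -[x [y [-> -> xy]]]; exists y, x; rewrite sedge_sym.
have EsubP u v : E u v -> [/\ u \in f @: setT, v \in f @: setT & sedge u v].
  by case/EP=> x [y [-> -> xy]]; rewrite !imset_f ?inE //; split=> //; apply: fE.
exists (Subgraph Esym EsubP).
have fin x : f x \in f @: setT by rewrite imset_f ?inE.
exists (fun x => exist _ (f x) (fin x)); split.
  apply: inj_card_bij; first by move=> x y [] /finj.
  by rewrite card_sig (card_imset _ finj) cardsT.
move=> x y; rewrite /= /subgraph_rel /=; apply/EP/idP => [[x' [y' [/finj -> /finj ->]]]//|xy].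
by exists x, y.
Qed.

Lemma pathwidth_leq (H : sgraph) (s : seq {set H}) k :
  path_decomposition s -> (forall B, B \in s -> #|B| <= k) -> pathwidth H <= k.-1.
Proof.
move=> sP sk; rewrite /pathwidth; case: ex_minnP => w _ wmin.
have /wmin/leq_trans : `[< exists2 s' : seq {set H}, path_decomposition s' & width s' = width s >].
  by apply/asboolP; exists s.
apply; rewrite /width -!subn1 leq_sub2r //.
by apply/bigmax_leqP_seq => B Bs _; apply: sk.
Qed.

(** [H] is the quotient on the colours in use; the second coordinate of a vertex is its position in
    its colour class. *)
Lemma decomposable_contained (G : sgraph) m k : decomposable m k [set: G] ->
  exists H : sgraph, pathwidth H <= k.-1 /\ contained G (strong_product H (complete_graph m)).
Proof.
case=> col [l [r [d1 d2 d3 d4 d5]]].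
pose cs := codom col.
pose C : finType := seq_sub cs.
pose c x : C := SeqSub (codom_f col x).
have cP (u : C) : exists x, u = c x.
  by case: u => u uc; have /codomP[x e] := uc; exists x; apply: val_inj.
have ccol x y : c x = c y -> col x = col y by case.
pose E : rel C := fun u v => (u != v) && [exists x, exists y, [&& u == c x, v == c y & sedge x y]].
have EP u v : reflect (u != v /\ exists x y, [/\ u = c x, v = c y & sedge x y]) (E u v).
  apply: (iffP andP) => -[nuv ex]; split=> //.
    by case/existsP: ex => x /existsP[y /and3P[/eqP-> /eqP-> xy]]; exists x, y.
  by case: ex => x [y [-> -> xy]]; apply/existsP; exists x; apply/existsP; exists y; rewrite !eqxx.
have Esym : symmetric E.
  move=> u v; apply/EP/EP=> -[n [x [y [e1 e2 xy]]]]; rewrite eq_sym; split=> //;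
  by exists y, x; rewrite sedge_sym.
have Eirr : irreflexive E by move=> u; rewrite /E eqxx.
pose H := SGraph Esym Eirr; exists H.
pose bag i : {set H} := [set u | [exists x, (u == c x) && (l x <= i <= r x)]].
have bagP i x : (c x \in bag i) = (l x <= i <= r x).
  rewrite inE; apply/existsP/idP => [[y /andP[/eqP/ccol e]]|h]; last by exists x; rewrite eqxx.
  by have [||-> ->//] := d2 x y _ _ e; rewrite inE.
pose N := (\max_x r x).+1.
have rN x : r x < N by rewrite ltnS leq_bigmax.
have lr x : l x <= r x by apply: d1; rewrite inE.
pose s := mkseq bag N.
have bagin i : i < N -> bag i \in s by move=> iN; apply/mapP; exists i; rewrite ?mem_iota.
split.
  apply: (pathwidth_leq (s := s)) => [|B /mapP[i _ ->]]; last first.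
    have [ds sds h] := d4 i; apply: leq_trans sds.
    have sub : {subset [seq val u | u <- enum (bag i)] <= ds}.
      move=> z /mapP[u ub ->]; rewrite mem_enum in ub; have [x e] := cP u.
      by rewrite e /=; apply: h; rewrite ?inE // -bagP -e.
    rewrite cardE -(size_map val); apply: uniq_leq_size sub.
    by rewrite map_inj_uniq ?enum_uniq //; apply: val_inj.
  split=> [u|u v /EP[_ [x [y [-> -> xy]]]]|u i j k' /andP[ij jk]].
  - have [x ->] := cP u; exists (bag (l x)); last by rewrite bagP leqnn lr.
    by apply: bagin; apply: leq_ltn_trans (lr x) (rN x).
  (* Using [d3] in both directions of the edge makes the two intervals overlap at the larger left
     end. *)
  - have h1 : l x <= r y by apply: d3; rewrite ?inE.
    have h2 : l y <= r x by apply: d3; rewrite ?inE // sedge_sym.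
    exists (bag (maxn (l x) (l y))); last first.
      by rewrite !bagP leq_maxl leq_maxr !geq_max h1 h2 !lr.
    by apply: bagin; rewrite gtn_max !(leq_ltn_trans (lr _) (rN _)).
  - rewrite size_mkseq => kN; have [x ->] := cP u.
    by rewrite !nth_mkseq ?bagP; lia.
pose cls x := [set y | col y == col x].
have idx x : index x (enum (cls x)) < m.
  apply: leq_trans (_ : #|cls x| <= m).
    by rewrite cardE index_mem mem_enum inE.
  apply: leq_trans (d5 (col x)); apply: subset_leq_card.
  by apply/subsetP=> y; rewrite !inE.
have finj : injective (fun x => (c x, Ordinal (idx x)) : strong_product H (complete_graph m)).
  move=> x y [e1 e2]; have ec : cls x = cls y by apply/setP=> z; rewrite !inE e1.
  rewrite ec in e2; have xi : x \in enum (cls y) by rewrite mem_enum -ec inE.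
  by rewrite -(nth_index x xi) e2 nth_index // mem_enum inE.
apply: (contained_inj finj) => x y xy.
have nxy : x != y by apply: contraTneq xy => ->; rewrite sedge_irrefl.
apply/and3P; split; rewrite /=.
- by apply: contra nxy => /eqP/finj ->.
- case: (eqVneq (c x) (c y)) => //= n; apply/EP; split=> //; by exists x, y.
- by rewrite /complete_rel; case: eqVneq.
Qed.

(** * Distances, centers and parent maps of trees *)

Lemma bigmin_leq_idx (I : finType) (P : pred I) (F : I -> nat) d :
  \big[minn/d]_(i | P i) F i <= d.
Proof. by elim/big_rec: _ => // i x _; rewrite geq_min => ->; rewrite orbT. Qed.

Lemma bigmin_leq (I : finType) (P : pred I) (F : I -> nat) d j :
  P j -> \big[minn/d]_(i | P i) F i <= F j.
Proof.
rewrite unlock => Pj; have := mem_index_enum j; elim: (index_enum I) => //= i s IH.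
rewrite inE => /orP[/eqP <-|/IH h]; first by rewrite Pj geq_min leqnn.
by case: ifP => // _; rewrite geq_min h orbT.
Qed.

Lemma bigmin_attained (I : finType) (P : pred I) (F : I -> nat) d :
  \big[minn/d]_(i | P i) F i = d \/ exists2 i, P i & \big[minn/d]_(i | P i) F i = F i.
Proof.
elim/big_rec: _ => [|i x Pi [->|[j Pj ->]]]; first by left.
  by case: (leqP (F i) d) => h; [right; exists i | left].
by case: (leqP (F i) (F j)) => h; right; [exists i | exists j].
Qed.

Lemma dist_path_leq (T : sgraph) (x : T) q :
  path (@sedge T) x q -> size q < #|T| -> dist x (last x q) <= size q.
Proof.
move=> qP qT; apply: (@bigmin_leq _ _ (@nat_of_ord _) _ (Ordinal qT)) => /=.
by apply/existsP; exists (in_tuple q); rewrite qP /= eqxx.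
Qed.

(** A path without repeated vertices has fewer than [#|T|] edges, which rules out the default value
    of the minimum. *)
Lemma dist_attained (T : sgraph) (x y : T) : connect (@sedge T) x y ->
  exists q, [/\ path (@sedge T) x q, last x q = y, size q = dist x y & size q < #|T|].
Proof.
case/connectP=> q0 q0P yE.
case/shortenP: q0P yE => q qP qu _ yE.
have qT : size q < #|T| by have := max_card (mem (x :: q)); rewrite (card_uniqP qu).
have dq : dist x y <= size q by rewrite yE dist_path_leq.
have [e|[i /existsP[p /andP[pP /eqP pl]] e]] := bigmin_attained
  (fun n : 'I_#|T| => [exists p : n.-tuple T, path (@sedge T) x p && (last x p == y)])
  (@nat_of_ord _) #|T|.
  by move: dq; rewrite /dist e leqNgt qT.
by exists p; rewrite size_tuple; split=> //; rewrite /dist e.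
Qed.

(* In a connected graph, distances from [r] give a spanning tree of parent edges;
   another edge would close a cycle with the tree path between its ends. *)
Lemma tree_parent (T : sgraph) (r : T) : is_tree T ->
  exists p : T -> T, [/\ forall v, p v != v -> dist r v = (dist r (p v)).+1,
    forall v, fconnect p v r
    & forall x y, sedge x y -> (p x = y /\ p x != x) \/ (p y = x /\ p y != y)].
Proof.
move=> [[_ cT] acT].
(* The vertex before [v] on a shortest path from [r] is one step closer to [r]. *)
have par v : v != r -> exists u, sedge u v && (dist r v == (dist r u).+1).
  move=> vr; have [q [qP ql qs qT]] := dist_attained (cT r v).
  case/lastP: q => [|q w] in qP ql qs qT; first by rewrite -ql eqxx in vr.
  rewrite last_rcons in ql; rewrite rcons_path ql in qP; case/andP: qP => qP uv.
  rewrite size_rcons in qs qT.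
  have [q' [q'P q'l q's q'T]] := dist_attained (cT r (last r q)).
  have h1 := dist_path_leq qP (ltnW qT).
  have h2 : dist r v <= (dist r (last r q)).+1.
    have q'vP : path (@sedge T) r (rcons q' v) by rewrite rcons_path q'P q'l.
    have := dist_path_leq q'vP; rewrite last_rcons size_rcons q's; apply.
    by apply: leq_ltn_trans qT; rewrite ltnS.
  by exists (last r q); rewrite uv; apply/eqP; lia.
pose p v := if v == r then r else odflt r [pick u | sedge u v && (dist r v == (dist r u).+1)].
have pP v : v != r -> sedge (p v) v /\ dist r v = (dist r (p v)).+1.
  move=> vr; rewrite /p (negPf vr); case: pickP => [u /andP[uv /eqP ->]//|n].
  by have [u] := par v vr; rewrite n.
have pr : p r = r by rewrite /p eqxx.
have rootN v : p v != v -> v != r by apply: contraNneq => ->; rewrite pr.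
have conn v : fconnect p v r.
  have [n] := ubnP (dist r v); elim: n => // n IH in v *; rewrite ltnS => dv.
  have [->|vr] := eqVneq v r; first exact: connect0.
  have [_ e] := pP v vr; apply: connect_trans (fconnect1 p v) (IH _ _).
  by rewrite -e.
exists p; split=> // [v /rootN/pP[]//|x y xy].
pose e : rel T := [rel u v | (sedge u v) && ((p u == v) || (p v == u))].
have esym : symmetric e by move=> u v; rewrite /e /= sedge_sym orbC.
have eroot v : connect e v r.
  have [n] := ubnP (dist r v); elim: n => // n IH in v *; rewrite ltnS => dv.
  have [->|vr] := eqVneq v r; first exact: connect0.
  have [h eq] := pP v vr; apply: connect_trans (IH (p v) _); last by rewrite -eq.
  by apply: connect1; rewrite /e /= sedge_sym h eqxx.
have nxy : x != y by apply: contraTneq xy => ->; rewrite sedge_irrefl.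
have : connect e x y.
  by apply: connect_trans (eroot x) _; rewrite (sym_connect_sym esym).
case/connectP=> q0 q0P yE; case/shortenP: q0P yE => q qP qu _ yE.
(* A path of parent edges from [x] to [y] with a single edge is the edge itself; a longer one closes
   up with it to a cycle on at least three vertices. *)
case: q => [|z [|z' q]] in qP qu yE.
- by rewrite /= in yE; rewrite yE eqxx in nxy.
- rewrite /= in yE; move: qP; rewrite /= -yE andbT => /andP[_ /orP[]/eqP h]; [left|right].
    by rewrite h eq_sym.
  by rewrite h.
suff /acT : ucycle (@sedge T) [:: x, z, z' & q] by [].
rewrite /ucycle qu andbT; change (path (@sedge T) x (rcons [:: z, z' & q] x)).
rewrite rcons_path -yE sedge_sym xy andbT.
by apply: sub_path qP => u v /andP[].
Qed.

Lemma radius_center (T : sgraph) : 0 < #|T| ->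
  exists r : T, forall v, dist r v <= radius T.
Proof.
move=> /card_gt0P[x0 _].
have [r hr] : exists r : T, eccentricity r <= radius T.
  (* If the minimum is the default [#|T|], any vertex serves, because [dist] never exceeds that
     default. *)
  rewrite /radius; case: (bigmin_attained predT (@eccentricity T) #|T|) => [->|[r _ ->]].
    exists x0; apply/bigmax_leqP => v _; exact: bigmin_leq_idx.
  by exists r.
by exists r => v; apply: leq_trans hr; apply: leq_bigmax.
Qed.

Theorem theorem3 (T G : sgraph) (t h : nat)
    (T_tree : is_tree T) (T_card : #|T| = t) (t_ge3 : 3 <= t)
    (T_radius : radius T = h) (G_minor_free : ~ minor T G) :
  exists H : sgraph,
    pathwidth H <= 2 * h - 1 /\
    contained G (strong_product H (complete_graph (t - 2))).
Proof.
have [|r rP] := @radius_center T; first by rewrite T_card; lia.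
have [p [lev_parent conn edges]] := tree_parent r T_tree.
(* Bags of at most [2 * h] parts give width at most [(2 * h).-1]. *)
rewrite subn1; apply: decomposable_contained; apply: contrapT => nd.
have [C [_ cC nC]] := undecomposable_component nd.
have [/set0Pn[a aC] _] := cC.
have m0 : 0 < t - 2 by lia.
(* Every vertex descends from [r], so a model of the subtree below [r] is one of all of [T]. *)
have descE : desc p r = setT by apply/setP=> v; rewrite !inE conn.
have bad : bad_has_model p (@decomposable G (t - 2) (2 * h)) r.
  apply: (undecomposable_has_model lev_parent) => // [w _|].
    by rewrite -T_radius (leq_trans (rP w)) // leq_addl.
  by rewrite descE cardsT T_card; lia.
have [beta [m1 m2 _ m4]] := bad C a cC aC nC.
rewrite descE in m1 m2 m4.
have adj v : p v != v -> exists x y, [/\ x \in beta v, y \in beta (p v) & sedge x y].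
  by move=> pv; apply: m4; rewrite ?inE // /top negb_or negbK inE pv.
apply: G_minor_free; exists beta; split=> [v|v w|v w /edges[][<- n]].
- by case: (m1 v (in_setT v)).
- by apply: m2; rewrite inE.
- exact: adj.
- by have [x [y [? ? ?]]] := adj w n; exists y, x; rewrite sedge_sym.
Qed.
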